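(* Let $1<p<\infty$, let $\varphi\in \mathrm{Aut}(\mathbb{D})$, and suppose that the composition operator $C_\varphi$ is bounded on the Besov space $B_p$. Then $C_\varphi$ is not hypercyclic on $B_p$.
   Context: $\mathbb{D}=\{z\in\mathbb{C}:|z|<1\}$, $H(\mathbb{D})$ is the space of holomorphic functions on $\mathbb{D}$, and $dA(z)=dx\,dy$ is Lebesgue area measure. $\mathrm{Aut}(\mathbb{D})$ is the set of one-to-one holomorphic maps of $\mathbb{D}$ onto itself. For a holomorphic self-map $\varphi$ of $\mathbb{D}$, $C_\varphi f=f\circ\varphi$ for $f\in H(\mathbb{D})$. For $1<p<\infty$, the Besov space is $B_p=\{f\in H(\mathbb{D}):\|f\|_{B_p}^p=\int_{\mathbb{D}}|f'(z)|^p(1-|z|^2)^{p-2}\,dA(z)<\infty\}$, a Banach space under the norm $\|f\|_p$ given by $\|f\|_p^p=|f(0)|^p+\|f\|_{B_p}^p$. ''$C_\varphi$ is bounded on $B_p$'' means that $C_\varphi$ is a bounded linear operator from $B_p$ to $B_p$. A continuous linear operator $T$ on a separable infinite-dimensional Banach space $X$ is hypercyclic if there is $f\in X$ whose orbit $\{T^nf:n=0,1,2,\dots\}$ is dense in $X$. *)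

(* Defs.v *)
From HB Require Import structures.
From mathcomp Require Import all_boot all_order all_algebra complex.
From mathcomp Require Import all_classical all_reals all_analysis.

Set Implicit Arguments.
Unset Strict Implicit.
Unset Printing Implicit Defensive.

Import Order.TTheory GRing.Theory Num.Theory.
Import numFieldNormedType.Exports.
Import ComplexField.Normc.

Local Open Scope classical_set_scope.
Local Open Scope ring_scope.
Local Open Scope complex_scope.

(* A function on the unit disc is represented by a total function on R[i].
   Every notion below that is applied to a function depends only on its
   restriction to the (open) disc, including the derivatives it uses. *)

Section Disc.
Context {R : realType}.

Definition unit_disc : set R[i] := [set z | `|z| < 1].

(* R[i]^o is R[i] as a normed module over itself, so that [derivable]
   and [derive1] are complex differentiability and the complex derivative. *)
Definition holomorphic_on_disc (f : R[i]^o -> R[i]^o) : Prop :=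
  forall z, unit_disc z -> derivable f z 1.

Definition disc_automorphism (phi : R[i]^o -> R[i]^o) : Prop :=
  holomorphic_on_disc phi /\ set_bij unit_disc unit_disc phi.

Definition composition_operator (phi f : R[i]^o -> R[i]^o) : R[i]^o -> R[i]^o :=
  f \o phi.

Definition area_measure : set (measurableTypeR R * measurableTypeR R) -> \bar R :=
  (@lebesgue_measure R \x @lebesgue_measure R)%E.

(* [normc] is the modulus with values in R, whereas [`|z|] lies in R[i]. *)
Definition besov_integral (p : R) (f : R[i]^o -> R[i]^o) : \bar R :=
  (\int[area_measure]_(w in [set w | unit_disc (w.1 +i* w.2)])
     (let z : R[i] := w.1 +i* w.2 in
      normc (derive1 f z) `^ p * (1 - normc z ^+ 2) `^ (p - 2))%:E)%E.

Definition besov (p : R) : set (R[i]^o -> R[i]^o) :=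
  [set f | holomorphic_on_disc f /\ (besov_integral p f < +oo)%E].

Definition besov_norm (p : R) (f : R[i]^o -> R[i]^o) : R :=
  (normc (f 0) `^ p + fine (besov_integral p f)) `^ p^-1.

Definition bounded_on_besov (p : R)
    (T : (R[i]^o -> R[i]^o) -> (R[i]^o -> R[i]^o)) : Prop :=
  [/\ forall (a : R[i]) f g, besov p f -> besov p g ->
        {in unit_disc, T (a *: f + g) =1 a *: T f + T g},
      forall f, besov p f -> besov p (T f)
    & exists M : R, forall f, besov p f ->
        besov_norm p (T f) <= M * besov_norm p f].

Definition orbit (T : (R[i]^o -> R[i]^o) -> (R[i]^o -> R[i]^o))
    (f : R[i]^o -> R[i]^o) : set (R[i]^o -> R[i]^o) :=
  range (fun n : nat => iter n T f).

(* S is intersected with the space because [besov_norm] is meaningless when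
   the Besov integral is infinite ([fine] sends +oo to 0). *)
Definition dense_in_besov (p : R) (S : set (R[i]^o -> R[i]^o)) : Prop :=
  forall g, besov p g -> forall e : R, 0 < e ->
    exists2 h, (S `&` besov p) h & besov_norm p (h - g) < e.

Definition hypercyclic_on_besov (p : R)
    (T : (R[i]^o -> R[i]^o) -> (R[i]^o -> R[i]^o)) : Prop :=
  exists2 f, besov p f & dense_in_besov p (orbit T f).

End Disc.

(* Main.v *)
Require Import Defs.
From HB Require Import structures.
From mathcomp Require Import all_boot all_order all_algebra complex.
From mathcomp Require Import all_classical all_reals all_analysis.
From mathcomp Require Import measurable_realfun.
From mathcomp Require Import ring lra.

Set Implicit Arguments.
Unset Strict Implicit.
Unset Printing Implicit Defensive.

Import Order.TTheory GRing.Theory Num.Theory.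
Import numFieldNormedType.Exports.
Import ComplexField.Normc.

Local Open Scope classical_set_scope.
Local Open Scope ring_scope.
Local Open Scope complex_scope.

Local Notation Re := complex.Re.
Local Notation Im := complex.Im.

(** The proof weighs functions on the disc by the Bloch seminorm
N(f) = sup (1 - |z|) |f'(z)|.

Composition with a holomorphic self-map of the disc multiplies N by at most 256,
whatever the self-map: this is the Schwarz-Pick inequality with a poor constant
([schwarz_pick_weak]). All powers of C_phi therefore share the factor 256. On the
other hand, N is finite on B_p and is small when the Besov seminorm is small
([besov_bloch]). Suppose the orbit of f is dense. Some f o phi^n is then close to
512 f in B_p, so 512 N(f) <= 256 N(f) + epsilon for every epsilon > 0, and
N(f) = 0. Hence f is constant, all functions of its orbit agree on the disc, and
the constant f(0) + 1 stays at distance at least 1 from them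
([self_map_not_hypercyclic]).

As lossy constants are harmless, all of the complex analysis is drawn from boundary
integrals over rectangles. Goursat's bisection argument ([goursat]) makes them
vanish for a function that is merely complex differentiable. If instead F has a
singularity z0 with (z - z0) F(z) -> L, then the rectangle can be shrunk to a tiny
square around z0, which shows that the integral of F is L times the integral of
1 / (z - z0). The imaginary part of the latter is at least 1, so L is bounded by the
integral of F ([residue_le]). This has two consequences.

- With F = (f - f(z0)) / (z - z0)^2 one gets Cauchy's estimate of f'(z0) by the
  supremum of |f| ([derive1_le_sup]). It yields [schwarz_pick_weak] when applied to
  the self-map followed by a Moebius transformation that sends its value at z0
  to 0.

- With F = g / (z - z0), on a rectangle whose four sides are chosen such that the
  integral of |g| along each of them is not much above average, one gets that |g(z0)| is
  bounded by the mean of |g| over a square ([area_mean]). Applied to difference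
  quotients of f and followed by dominated convergence, it gives the same bound for
  g = f', without a proof that f' is holomorphic ([area_mean_derive1]). Because
  1 - |w|^2 is comparable to 1 - |z0| on a square of side proportional to 1 - |z0|,
  and t <= a + a^(1-p) t^p for all a > 0, this mean is controlled by the Besov
  integral, which is [besov_bloch]. *)

(** * Modulus and differentiability of complex functions *)

Section Modulus.
Context {R : realType}.
Implicit Types z w : R[i].

Lemma normr_normc z : `|z| = (normc z)%:C.
Proof. by rewrite normc_def; case: z. Qed.

Lemma normc_ge0 z : 0 <= normc z.
Proof. by case: z => a b; exact: sqrtr_ge0. Qed.

Lemma normc_eq0 z : (normc z == 0) = (z == 0).
Proof. by apply/eqP/eqP => [/eq0_normc//|->]; rewrite normc0. Qed.

Lemma normc_gt0 z : (0 < normc z) = (z != 0).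
Proof. by rewrite lt_neqAle normc_ge0 andbT eq_sym normc_eq0. Qed.

Lemma normcB z w : normc (z - w) = normc (w - z).
Proof. by rewrite -normcN opprB. Qed.

Lemma normc_real (x : R) : normc x%:C = `|x|.
Proof. by rewrite /= expr0n addr0 sqrtr_sqr. Qed.

Lemma le_Re_normc z : `|Re z| <= normc z.
Proof. by rewrite -lecR -normr_normc normc_ge_Re. Qed.

Lemma le_Im_normc z : `|Im z| <= normc z.
Proof.
case: z => a b /=; rewrite -sqrtr_sqr ler_wsqrtr// lerDr sqr_ge0//.
Qed.

Lemma normc_le z : normc z <= `|Re z| + `|Im z|.
Proof.
case: z => a b /=; rewrite -[leRHS]ger0_norm ?addr_ge0// -sqrtr_sqr ler_wsqrtr//.
rewrite sqrrD !real_normK ?num_real// -addrA lerD2l lerDr.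
by rewrite mulrn_wge0// mulr_ge0.
Qed.

Lemma normc_div z w : normc (z / w) = normc z / normc w.
Proof. by rewrite normcM normcV. Qed.

Lemma normc_i : normc ('i : R[i]) = 1.
Proof. by rewrite /= expr0n add0r expr1n sqrtr1. Qed.

Lemma ler_dist_normc z w : `|normc z - normc w| <= normc (z - w).
Proof.
have := le_normcD (z - w) w; have := le_normcD (w - z) z.
by rewrite !subrK (normcB w) ler_norml => ? ?; apply/andP; split; lra.
Qed.

Lemma unit_discE z : unit_disc z <-> normc z < 1.
Proof. by rewrite /unit_disc /= normr_normc -[1 in X in X <-> _]/(1%:C) ltcR. Qed.

End Modulus.

Section Derivative.
Context {R : realType}.
Implicit Types (f g : R[i]^o -> R[i]^o) (z l : R[i]).

(** The limit is taken over points other than [z], with real epsilon and delta; in the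
topology of [R[i]^o] the radii are themselves elements of [R[i]]. *)
Definition tends_at f z l := forall e : R, 0 < e -> exists2 d : R, 0 < d &
  forall w, normc (w - z) < d -> w != z -> normc (f w - l) <= e.

Lemma derivable_tends f z : derivable f z 1 ->
  tends_at (fun w => (f w - f z) / (w - z)) z (derive1 f z).
Proof.
move=> df e e0.
have : (fun h : R[i]^o => h^-1 *: (f (h + z) - f z)) @ 0^' --> derive1 f z.
  have := df; rewrite /derivable derive1E /derive.
  by under eq_fun do rewrite /= scaler1.
move/cvgrPdist_le => /(_ e%:C).
rewrite ltcR => /(_ e0) [d /= d0 dP].
have dr : d \is Num.real by exact: gtr0_real.
have dE : d = (Re d)%:C by rewrite RRe_real.
exists (Re d); first by rewrite -ltcR -dE.
move=> w wd wz.
have := dP (w - z); rewrite /= sub0r normrN normr_normc dE ltcR => /(_ wd).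
rewrite subr_eq0 => /(_ wz); rewrite normr_normc lecR subrK normcB.
by rewrite /GRing.scale /= mulrC.
Qed.

End Derivative.

(** * Integrals of complex functions over segments *)

Section Continuity.
Context {R : realType}.
Implicit Types (f g : R[i]^o -> R[i]^o) (z l : R[i]).

Lemma derivable_eps_continuous f z : derivable f z 1 -> forall e : R, 0 < e ->
  exists2 d : R, 0 < d & forall w, normc (w - z) < d -> normc (f w - f z) <= e.
Proof.
move=> /derivable1_diffP/differentiable_continuous cf e e0.
move/cvgrPdist_le : cf => /(_ e%:C); rewrite ltcR => /(_ e0) [d /= d0 dP].
have dr : d \is Num.real by exact: gtr0_real.
have dE : d = (Re d)%:C by rewrite RRe_real.
exists (Re d); first by rewrite -ltcR -dE.
move=> w wd; have := dP w; rewrite /= !normr_normc dE ltcR lecR.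
by rewrite normcB => /(_ wd); rewrite normcB.
Qed.

(** Continuity is stated at points of the segment but with all real neighbours, so that
it follows from complex differentiability at the points of the segment alone. *)
Lemma within_continuous_eps (a b : R) (u : R -> R) :
  (forall x, a <= x <= b -> forall e, 0 < e ->
    exists2 d, 0 < d & forall y, `|y - x| < d -> `|u y - u x| <= e) ->
  {within `[a, b], continuous u}.
Proof.
move=> H; apply: continuous_in_subspaceT => x; rewrite inE /= in_itv /= => xab.
apply/cvgrPdist_le => e e0; have [d d0 dP] := H x xab e e0.
near=> y; rewrite distrC; apply: dP.
by near: y; exists d => //= y; rewrite distrC.
Unshelve. all: by end_near. Qed.

End Continuity.

Section SegmentIntegral.
Context {R : realType}.
Notation mu := (@lebesgue_measure R).
Implicit Types (a b m : R) (g h : R -> R[i]).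

Definition cintegral a b g : R[i] :=
  (\int[mu]_(x in `[a, b]) Re (g x)) +i* (\int[mu]_(x in `[a, b]) Im (g x)).

Definition cintegrable a b g : Prop :=
  mu.-integrable `[a, b] (EFin \o (fun x => Re (g x))) /\
  mu.-integrable `[a, b] (EFin \o (fun x => Im (g x))).

Lemma integrable_scale a b (r : R) (u : measurableTypeR R -> R) :
  mu.-integrable `[a, b] (EFin \o u) ->
  mu.-integrable `[a, b] (EFin \o (fun x => r * u x)).
Proof.
move=> iu; apply: (eq_integrable _ (fun x => (r%:E * (EFin \o u) x)%E)) => //.
exact: integrableZl.
Qed.

Lemma cintegralD a b g h : cintegrable a b g -> cintegrable a b h ->
  cintegral a b (fun x => g x + h x) = cintegral a b g + cintegral a b h.
Proof.
move=> [g1 g2] [h1 h2]; rewrite /cintegral.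
rewrite -[RHS]/((_ + _) +i* (_ + _)) -!RintegralD//.
by congr (_ +i* _); apply: eq_Rintegral => x _; rewrite raddfD.
Qed.

Lemma cintegralZ a b g (c : R[i]) : cintegrable a b g ->
  cintegral a b (fun x => c * g x) = c * cintegral a b g.
Proof.
move=> [g1 g2]; rewrite /cintegral; case: c => p q.
rewrite -[RHS]/((_ - _) +i* (_ + _)) -!RintegralZl//.
rewrite -RintegralB ?integrable_scale// -RintegralD ?integrable_scale//.
by congr (_ +i* _); apply: eq_Rintegral => x _; case: (g x).
Qed.

Lemma cintegrableZ a b g (c : R[i]) : cintegrable a b g ->
  cintegrable a b (fun x => c * g x).
Proof.
move=> [g1 g2]; case: c => p q.
split.
  apply: eq_integrable
    (integrableB _ (integrable_scale p g1) (integrable_scale q g2)) => // x _ /=.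
  by case: (g x).
apply: eq_integrable
  (integrableD _ (integrable_scale p g2) (integrable_scale q g1)) => // x _ /=.
by case: (g x).
Qed.

Lemma cintegralB a b g h : cintegrable a b g -> cintegrable a b h ->
  cintegral a b (fun x => g x - h x) = cintegral a b g - cintegral a b h.
Proof.
move=> ig ih; rewrite -mulN1r -cintegralZ// -cintegralD//; last exact: cintegrableZ.
by congr (_ +i* _); apply: eq_Rintegral => x _; rewrite mulN1r.
Qed.

Lemma cintegrable_sub a b a' b' g : a <= a' -> b' <= b -> cintegrable a b g ->
  cintegrable a' b' g.
Proof.
move=> aa bb [g1 g2].
have s : `[a', b'] `<=` `[a, b] by apply: subset_itv; rewrite bnd_simp.
by split; [move: g1 | move: g2]; apply: integrableS.
Qed.

Lemma cintegral_split m a b g : a <= m <= b -> cintegrable a b g ->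
  cintegral a b g = cintegral a m g + cintegral m b g.
Proof.
move=> /andP[am mb] ig; have [g1 g2] := ig.
have [h1 h2] : cintegrable m b g by apply: cintegrable_sub ig.
rewrite /cintegral -[RHS]/((_ + _) +i* (_ + _)).
congr (_ +i* _); apply/eqP; rewrite addrC -subr_eq; apply/eqP.
  rewrite Rintegral_itvB ?bnd_simp// Rintegral_itv_obnd_cbnd//.
  by apply: integrableS h1 => //; apply: subset_itvr; rewrite bnd_simp.
rewrite Rintegral_itvB ?bnd_simp// Rintegral_itv_obnd_cbnd//.
by apply: integrableS h2 => //; apply: subset_itvr; rewrite bnd_simp.
Qed.

Lemma eq_cintegral a b g h : (forall x, a <= x <= b -> g x = h x) ->
  cintegral a b g = cintegral a b h.
Proof.
move=> gh; congr (_ +i* _); apply: eq_Rintegral => x; rewrite inE/= in_itv/= => xab;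
  by rewrite gh.
Qed.

Lemma cintegral_norm_le a b g : cintegrable a b g ->
  normc (cintegral a b g) <= \int[mu]_(x in `[a, b]) `|Re (g x)| +
                           \int[mu]_(x in `[a, b]) `|Im (g x)|.
Proof.
move=> [g1 g2]; apply: (le_trans (normc_le _)); apply: lerD => /=;
  exact: le_normr_Rintegral.
Qed.

Lemma integrable_itv_cst a b (k : R) : mu.-integrable `[a, b] (EFin \o (fun=> k)).
Proof.
apply: continuous_compact_integrable; first exact: segment_compact.
by apply: continuous_subspaceT => x; exact: cst_continuous.
Qed.

Lemma Rintegral_itv_cst a b (k : R) : a <= b ->
  \int[mu]_(x in `[a, b]) k = k * (b - a).
Proof.
move=> ab; rewrite Rintegral_cst//= lebesgue_measure_itv/= lte_fin.
by case: ltgtP ab => //= -> _; rewrite subrr.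
Qed.

(** The factor 2 comes from bounding the real and imaginary parts separately; this
avoids the usual rotation argument. *)
Lemma cintegral_bound a b g M : a <= b -> cintegrable a b g ->
  (forall x, a <= x <= b -> normc (g x) <= M) ->
  normc (cintegral a b g) <= 2 * (M * (b - a)).
Proof.
move=> ab ig gM; apply: (le_trans (cintegral_norm_le ig)).
have iM := integrable_itv_cst a b M.
rewrite [leRHS]mulrDl mul1r -(Rintegral_itv_cst M ab); case: ig => g1 g2; apply: lerD.
  apply: le_Rintegral => //; first exact: integrable_norm.
  move=> x; rewrite /= in_itv /= => /gM; exact: le_trans (le_Re_normc _).
apply: le_Rintegral => //; first exact: integrable_norm.
move=> x; rewrite /= in_itv /= => /gM; exact: le_trans (le_Im_normc _).
Qed.

Lemma cintegrable_continuous a b g :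
  (forall x, a <= x <= b -> forall e, 0 < e ->
    exists2 d, 0 < d & forall y, `|y - x| < d -> normc (g y - g x) <= e) ->
  cintegrable a b g.
Proof.
move=> H; split; apply: continuous_compact_integrable;
  do ?exact: segment_compact; apply: within_continuous_eps => x xab e e0;
  have [d d0 dP] := H x xab e e0; exists d => // y /dP; apply: le_trans;
  rewrite -raddfB; [exact: le_Re_normc | exact: le_Im_normc].
Qed.

Lemma cintegrable_hseg a b y (f : R[i]^o -> R[i]^o) :
  (forall x, a <= x <= b -> derivable f (x +i* y) 1) ->
  cintegrable a b (fun x => f (x +i* y)).
Proof.
move=> df; apply: cintegrable_continuous => x xab e e0.
have [d d0 dP] := derivable_eps_continuous (df x xab) e0.
exists d => // x' xd; apply: dP; apply: le_lt_trans xd.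
by apply: (le_trans (normc_le _)); rewrite /= subrr normr0 addr0.
Qed.

Lemma cintegrable_vseg x c d (f : R[i]^o -> R[i]^o) :
  (forall y, c <= y <= d -> derivable f (x +i* y) 1) ->
  cintegrable c d (fun y => f (x +i* y)).
Proof.
move=> df; apply: cintegrable_continuous => y yab e e0.
have [t d0 dP] := derivable_eps_continuous (df y yab) e0.
exists t => // x' xd; apply: dP; apply: le_lt_trans xd.
by apply: (le_trans (normc_le _)); rewrite /= subrr normr0 add0r.
Qed.

End SegmentIntegral.

(** * Integrals along the boundary of a rectangle *)

Section Rectangle.
Context {R : realType}.
Implicit Types (a b c d m : R) (f g : R[i]^o -> R[i]^o).

Definition rect_integral a b c d f : R[i] :=
  cintegral a b (fun x => f (x +i* c)) - cintegral a b (fun x => f (x +i* d)) +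
  'i * (cintegral c d (fun y => f (b +i* y)) -
        cintegral c d (fun y => f (a +i* y))).

Definition rect_integrable a b c d f : Prop :=
  [/\ cintegrable a b (fun x => f (x +i* c)),
      cintegrable a b (fun x => f (x +i* d)),
      cintegrable c d (fun y => f (b +i* y)) &
      cintegrable c d (fun y => f (a +i* y))].

Definition holomorphic_on_rect a b c d f : Prop :=
  forall x y, a <= x <= b -> c <= y <= d -> derivable f (x +i* y) 1.

Lemma holomorphic_rect_integrable a b c d f : a <= b -> c <= d ->
  holomorphic_on_rect a b c d f -> rect_integrable a b c d f.
Proof.
move=> ab cd hf; split.
- by apply: cintegrable_hseg => x xab; apply: hf => //; rewrite lexx.
- by apply: cintegrable_hseg => x xab; apply: hf => //; rewrite lexx cd.
- by apply: cintegrable_vseg => x xab; apply: hf => //; rewrite lexx ab.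
- by apply: cintegrable_vseg => x xab; apply: hf => //; rewrite lexx.
Qed.

Lemma rect_integralD a b c d f g :
  rect_integrable a b c d f -> rect_integrable a b c d g ->
  rect_integral a b c d (f + g) = rect_integral a b c d f + rect_integral a b c d g.
Proof.
move=> [f1 f2 f3 f4] [g1 g2 g3 g4]; rewrite /rect_integral.
rewrite (cintegralD f1 g1) (cintegralD f2 g2) (cintegralD f3 g3).
rewrite (cintegralD f4 g4); ring.
Qed.

Lemma rect_integralZ a b c d f (k : R[i]) :
  rect_integrable a b c d f ->
  rect_integral a b c d (fun z => k * f z) = k * rect_integral a b c d f.
Proof.
move=> [f1 f2 f3 f4]; rewrite /rect_integral.
rewrite (cintegralZ k f1) (cintegralZ k f2) (cintegralZ k f3).
rewrite (cintegralZ k f4); ring.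
Qed.

Lemma rect_integral_bound a b c d f M : a <= b -> c <= d ->
  rect_integrable a b c d f ->
  (forall x, a <= x <= b -> normc (f (x +i* c)) <= M) ->
  (forall x, a <= x <= b -> normc (f (x +i* d)) <= M) ->
  (forall y, c <= y <= d -> normc (f (b +i* y)) <= M) ->
  (forall y, c <= y <= d -> normc (f (a +i* y)) <= M) ->
  normc (rect_integral a b c d f) <= 4 * M * ((b - a) + (d - c)).
Proof.
move=> ab cd [f1 f2 f3 f4] M1 M2 M3 M4; rewrite /rect_integral.
apply: (le_trans (le_normcD _ _)); rewrite normcM normc_i mul1r.
have b1 := le_trans (le_normcD _ (- _)) (lerD (cintegral_bound ab f1 M1)
   (etrans (congr1 (<=%R^~ _) (normcN _)) (cintegral_bound ab f2 M2))).
have b2 := le_trans (le_normcD _ (- _)) (lerD (cintegral_bound cd f3 M3)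
   (etrans (congr1 (<=%R^~ _) (normcN _)) (cintegral_bound cd f4 M4))).
apply: (le_trans (lerD b1 b2)); lra.
Qed.

Lemma rect_integral_hsplit m a b c d f : a <= m <= b ->
  cintegrable a b (fun x => f (x +i* c)) ->
  cintegrable a b (fun x => f (x +i* d)) ->
  rect_integral a b c d f = rect_integral a m c d f + rect_integral m b c d f.
Proof.
move=> amb f1 f2; rewrite /rect_integral.
rewrite (cintegral_split amb f1) (cintegral_split amb f2); ring.
Qed.

Lemma rect_integral_vsplit m a b c d f : c <= m <= d ->
  cintegrable c d (fun y => f (b +i* y)) ->
  cintegrable c d (fun y => f (a +i* y)) ->
  rect_integral a b c d f = rect_integral a b c m f + rect_integral a b m d f.
Proof.
move=> amb f1 f2; rewrite /rect_integral.
rewrite (cintegral_split amb f1) (cintegral_split amb f2); ring.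
Qed.

Lemma cintegral_cst a b (k : R[i]) : a <= b ->
  cintegral a b (fun=> k) = (b - a)%:C * k.
Proof.
move=> ab; rewrite /cintegral.
rewrite !Rintegral_itv_cst//; case: k => p q.
rewrite -[RHS]/((_ - _) +i* (_ + _)) !mul0r subr0 addr0.
by congr (_ +i* _); rewrite mulrC.
Qed.

(** On opposite sides an affine function differs by a constant, so that only integrals
of constants are needed: those of the horizontal sides give [-i (d - c) (b - a)] and
those of the vertical sides the opposite. *)
Lemma rect_integral_affine a b c d (p q : R[i]) : a <= b -> c <= d ->
  rect_integral a b c d (fun z => p + q * z) = 0.
Proof.
move=> ab cd.
have hid : rect_integrable a b c d id.
  by apply: holomorphic_rect_integrable => // x y _ _; exact: derivable_id.
have hcst : rect_integrable a b c d (cst 1).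
  by apply: holomorphic_rect_integrable => // x y _ _; exact: derivable_cst.
rewrite (_ : (fun z => p + q * z) = (fun z => p * cst 1 z) + (fun z => q * id z));
  last by apply/funext => z; rewrite -[RHS]/(_ + _) /= mulr1.
have [i1 i2 i3 i4] := hid; have [j1 j2 j3 j4] := hcst.
rewrite rect_integralD; last 2 first.
- by split; exact: cintegrableZ.
- by split; exact: cintegrableZ.
rewrite !rect_integralZ// /rect_integral /= -!cintegralB//.
rewrite (@eq_cintegral _ a b (fun x => x +i* c - x +i* d) (fun=> (c - d)%:C * 'i));
  last first.
  by move=> x _; apply/eqP; rewrite eq_complex /=; apply/andP; split; apply/eqP; ring.
rewrite (@eq_cintegral _ c d (fun y => b +i* y - a +i* y) (fun=> (b - a)%:C));
  last first.
  by move=> x _; apply/eqP; rewrite eq_complex /=; apply/andP; split; apply/eqP; ring.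
rewrite !cintegral_cst// !rmorphB /=; ring.
Qed.

End Rectangle.

Local Arguments normc {R} x : simpl never.
Local Arguments rect_integral {R} a b c d f : simpl never.
Local Arguments cintegral {R} a b g : simpl never.

(** * Goursat's theorem for rectangles *)

Section Goursat.
Context {R : realType}.
Implicit Types (a b c d x y w h t : R) (f g : R[i]^o -> R[i]^o).

Lemma nested_intervals (u v : nat -> R) :
  (forall n, u n <= u n.+1) -> (forall n, v n.+1 <= v n) ->
  (forall n, u n <= v n) -> exists l, forall n, u n <= l <= v n.
Proof.
move=> uS vS uv.
have un m n : (m <= n)%N -> u m <= u n.
  elim: n => [|n IH]; rewrite leq_eqVlt => /predU1P[->//|//].
  by rewrite ltnS => /IH/le_trans; exact.
have vn m n : (m <= n)%N -> v n <= v m.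
  elim: n => [|n IH]; rewrite leq_eqVlt => /predU1P[->//|//].
  by rewrite ltnS => /IH; exact: le_trans.
have ub n : ubound (range u) (v n).
  move=> _ [m _ <-]; case: (leqP m n) => mn; first exact: (le_trans (un _ _ mn)).
  exact: (le_trans (uv m) (vn _ _ (ltnW mn))).
exists (sup (range u)) => n; apply/andP; split.
  by apply: ub_le_sup; [exists (v 0); exact: ub | exists n].
by apply: ge_sup => //; exists (u 0), 0%N.
Qed.

Lemma derivable_first_order f (z : R[i]) : derivable f z 1 ->
  forall e : R, 0 < e -> exists2 d : R, 0 < d & forall w : R[i], normc (w - z) < d ->
    normc (f w - (f z + derive1 f z * (w - z))) <= e * normc (w - z).
Proof.
move=> /derivable_tends df e /df[d d0 dP]; exists d => // w wd.
have [->|wz] := eqVneq w z; first by rewrite !subrr mulr0 addr0 subrr normc0 mulr0.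
have wz0 : w - z != 0 by rewrite subr_eq0.
have := dP w wd wz; rewrite -(ler_pM2r (_ : 0 < normc (w - z))) ?normc_gt0//.
by apply: le_trans; rewrite -normcM mulrBl divfK// opprD addrA.
Qed.

(** The integrals over the four quarters add up to the whole one, hence one of them has
at least a quarter of its modulus. *)
Lemma rect_integral_quarter x y w h f : 0 <= w -> 0 <= h ->
  holomorphic_on_rect x (x + 2 * w) y (y + 2 * h) f ->
  exists q : R * R, [/\ x <= q.1 <= x + w, y <= q.2 <= y + h &
    normc (rect_integral x (x + 2 * w) y (y + 2 * h) f) <=
    4 * normc (rect_integral q.1 (q.1 + w) q.2 (q.2 + h) f)].
Proof.
move=> w0 h0 hf.
have r1 : x <= x <= x + w by apply/andP; split; lra.
have r2 : y <= y <= y + h by apply/andP; split; lra.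
have r3 : x <= x + w <= x + w by apply/andP; split; lra.
have r4 : y <= y + h <= y + h by apply/andP; split; lra.
have sub x1 x2 y1 y2 : x <= x1 -> x1 <= x2 -> x2 <= x + 2 * w -> y <= y1 ->
    y1 <= y2 -> y2 <= y + 2 * h -> rect_integrable x1 x2 y1 y2 f.
  move=> *; apply: holomorphic_rect_integrable => // s t /andP[? ?] /andP[? ?].
  by apply: hf; apply/andP; split; lra.
have [i1 i2 i3 i4] : rect_integrable x (x + 2 * w) y (y + 2 * h) f by apply: sub; lra.
have [j1 j2 j3 j4] : rect_integrable x (x + w) y (y + 2 * h) f by apply: sub; lra.
have [k1 k2 k3 k4] : rect_integrable (x + w) (x + 2 * w) y (y + 2 * h) f by apply: sub; lra.
rewrite (@rect_integral_hsplit _ (x + w))//; last by apply/andP; split; lra.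
rewrite (@rect_integral_vsplit _ (y + h) x)//; last by apply/andP; split; lra.
rewrite (@rect_integral_vsplit _ (y + h) (x + w))//; last by apply/andP; split; lra.
have -> : x + 2 * w = x + w + w by ring.
have -> : y + 2 * h = y + h + h by ring.
set A := rect_integral _ _ _ _ _; set B := rect_integral _ _ _ _ _.
set C := rect_integral _ _ _ _ _; set D := rect_integral _ _ _ _ _.
have T : normc (A + B + (C + D)) <= normc A + normc B + (normc C + normc D).
  by apply: (le_trans (le_normcD _ _)); apply: lerD; exact: le_normcD.
case: (lerP (normc (A + B + (C + D))) (4 * normc A)) => [?|a1]; first by exists (x, y).
case: (lerP (normc (A + B + (C + D))) (4 * normc B)) => [?|b1]; first by exists (x, y + h).
case: (lerP (normc (A + B + (C + D))) (4 * normc C)) => [?|c1]; first by exists (x + w, y).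
exists (x + w, y + h); split => //=; rewrite -/D.
by move: T a1 b1 c1; clear; clearbody A B C D; lra.
Qed.

(** Repeated quartering gives rectangles that shrink to a point, the n-th of which
carries at least [4 ^- n] times the modulus of the integral. Near that point the function is
affine up to an error [e * |w - z|], the affine part integrates to 0, and the error
contributes at most [e] times the squared size of the rectangle, which is [4 ^- n] times a
constant. *)
Lemma goursat a b c d f : a <= b -> c <= d ->
  holomorphic_on_rect a b c d f -> rect_integral a b c d f = 0.
Proof.
move=> ab cd hf.
have [w wE0] : {w | b = a + w} by exists (b - a); ring.
have [h hE0] : {h | d = c + h} by exists (d - c); ring.
have [s [sz sp sS sl]] : exists s : nat -> R, [/\ s 0%N = 1, forall n, 0 < s n,
    forall n, s n = 2 * s n.+1 & forall e, 0 < e -> exists n, s n < e].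
  exists (fun n => 2^-1 ^+ n); split => [|n|n|e e0]; first exact: expr0.
  - by rewrite exprn_gt0.
  - by rewrite exprS mulrA divff ?mul1r.
  - have /cvgrPdist_lt/(_ e e0) : 2^-1 ^+ n @[n --> \oo] --> (0 : R).
      by apply: cvg_expr; rewrite ger0_norm; lra.
    move=> [n _ nP]; exists n.
    by have := nP n (leqnn n); rewrite /= sub0r normrN ger0_norm// exprn_ge0.
have w0 : 0 <= w by lra.
have h0 : 0 <= h by lra.
have s0 n : 0 <= s n by rewrite ltW.
have ws n : 0 <= w * s n by rewrite mulr_ge0.
have hs n : 0 <= h * s n by rewrite mulr_ge0.
pose I n (q : R * R) :=
  normc (rect_integral q.1 (q.1 + w * s n) q.2 (q.2 + h * s n) f).
have wE n : 2 * (w * s n.+1) = w * s n by rewrite (sS n); ring.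
have hE n : 2 * (h * s n.+1) = h * s n by rewrite (sS n); ring.
(* The side condition is put inside the existential so that choice applies to all
   corners at once. *)
have step (nq : nat * (R * R)) : exists q' : R * R,
    holomorphic_on_rect nq.2.1 (nq.2.1 + w * s nq.1) nq.2.2 (nq.2.2 + h * s nq.1) f ->
    [/\ nq.2.1 <= q'.1 <= nq.2.1 + w * s nq.1.+1,
        nq.2.2 <= q'.2 <= nq.2.2 + h * s nq.1.+1 & I nq.1 nq.2 <= 4 * I nq.1.+1 q'].
  case: nq => n [x y] /=.
  have [H|nH] := pselect (holomorphic_on_rect x (x + w * s n) y (y + h * s n) f);
    last by exists (x, y).
  move: (H); rewrite -wE -hE => /(rect_integral_quarter (ws n.+1) (hs n.+1))[q0 Q].
  by exists q0 => _; case: Q => ? ?; rewrite wE hE.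
have [next nextP] := choice step.
pose q := fix q n := if n is n'.+1 then next (n', q n') else (a, c).
have inv n : [/\ a <= (q n).1, (q n).1 + w * s n <= b, c <= (q n).2 &
    (q n).2 + h * s n <= d].
  elim: n => [|n [q1 q2 q3 q4]].
    by rewrite /= sz; split; lra.
  have Hn : holomorphic_on_rect (q n).1 ((q n).1 + w * s n) (q n).2 ((q n).2 + h * s n) f.
    by move=> x y /andP[? ?] /andP[? ?]; apply: hf; apply/andP; split; lra.
  have [/andP[? ?] /andP[? ?] _] := nextP (n, q n) Hn.
  by rewrite /=; split; have := wE n; have := hE n; lra.
have Hn n : holomorphic_on_rect (q n).1 ((q n).1 + w * s n) (q n).2 ((q n).2 + h * s n) f.
  have [q1 q2 q3 q4] := inv n.
  by move=> x y /andP[? ?] /andP[? ?]; apply: hf; apply/andP; split; lra.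
have [x xP] : exists x, forall n, (q n).1 <= x <= (q n).1 + w * s n.
  apply: nested_intervals => n; have := wE n; have := ws n.+1; have := ws n;
  have [/andP[? ?] /andP[? ?] _] := nextP (n, q n) (Hn n); rewrite /=; lra.
have [y yP] : exists y, forall n, (q n).2 <= y <= (q n).2 + h * s n.
  apply: nested_intervals => n; have := hE n; have := hs n.+1; have := hs n;
  have [/andP[? ?] /andP[? ?] _] := nextP (n, q n) (Hn n); rewrite /=; lra.
have IS n : I 0%N (a, c) <= 4 ^+ n * I n (q n).
  elim: n => [|n IH]; first by rewrite expr0 mul1r.
  apply: (le_trans IH); have [_ _ IL] := nextP (n, q n) (Hn n).
  by rewrite exprSr -mulrA ler_wpM2l ?exprn_ge0.
have small e : 0 < e -> I 0%N (a, c) <= e * (4 * (w + h) ^+ 2).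
  move=> e0; have dz : derivable f (x +i* y) 1.
    have := xP 0%N; have := yP 0%N; rewrite /= sz => /andP[? ?] /andP[? ?].
    by apply: hf; apply/andP; split; lra.
  have [r r0 rP] := derivable_first_order dz e0.
  have [n nr] : exists n, (w + h) * s n < r.
    have K0 : 0 < (w + h) + 1 by lra.
    have [n nP] : exists n, s n < r / (w + h + 1) by apply: sl; rewrite divr_gt0.
    exists n; move: nP; rewrite ltr_pdivlMr// => nP; have := s0 n; nra.
  apply: (le_trans (IS n)).
  pose l := derive1 f (x +i* y); pose p := f (x +i* y) - l * (x +i* y).
  pose aff : R[i]^o -> R[i]^o := fun z => p + l * z.
  pose g : R[i]^o -> R[i]^o := f - aff.
  have daff z : derivable aff z 1.
    apply: derivableD; first exact: derivable_cst.
    by apply: derivableM; [exact: derivable_cst|exact: derivable_id].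
  pose X := (q n).1; pose Y := (q n).2.
  have wn := ws n; have hn := hs n.
  have Xw : X <= X + w * s n by lra.
  have Yw : Y <= Y + h * s n by lra.
  have fE : f = g + aff by rewrite subrK.
  have hg : holomorphic_on_rect X (X + w * s n) Y (Y + h * s n) g.
    by move=> s1 s2 H1 H2; exact: (derivableB (Hn _ _ _ H1 H2) (daff _)).
  have ig := holomorphic_rect_integrable Xw Yw hg.
  have IE : I n (q n) = normc (rect_integral X (X + w * s n) Y (Y + h * s n) g).
    rewrite /I -/X -/Y {1}fE (rect_integralD ig); last first.
      exact: (holomorphic_rect_integrable Xw Yw (fun _ _ _ _ => daff _)).
    by rewrite (rect_integral_affine _ _ Xw Yw) addr0.
  have gb s1 s2 : X <= s1 <= X + w * s n -> Y <= s2 <= Y + h * s n ->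
      normc (g (s1 +i* s2)) <= e * ((w + h) * s n).
    move=> /andP[H1 H2] /andP[H3 H4].
    have := xP n; have := yP n; rewrite -/X -/Y => /andP[? ?] /andP[? ?].
    have nb : normc (s1 +i* s2 - x +i* y) <= (w + h) * s n.
      apply: (le_trans (normc_le _)); rewrite /= mulrDl; apply: lerD; rewrite ler_norml;
      by apply/andP; split; lra.
    have := rP (s1 +i* s2) (le_lt_trans nb nr).
    rewrite (_ : f (x +i* y) + _ = aff (s1 +i* s2)); last first.
      by rewrite /aff /p -/l; ring.
    move=> /le_trans; apply; rewrite ler_pM2l//.
  rewrite IE; apply: (le_trans (ler_wpM2l _ (rect_integral_bound Xw Yw ig _ _ _ _))).
  - by rewrite exprn_ge0.
  - by move=> u uP; apply: gb => //; rewrite lexx.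
  - by move=> u uP; apply: gb => //; rewrite lexx Yw.
  - by move=> u uP; apply: gb => //; rewrite lexx Xw.
  - by move=> u uP; apply: gb => //; rewrite lexx.
  have -> : 4 ^+ n = (s n)^-1 ^+ 2.
    elim: (n) => [|k IH]; first by rewrite sz invr1 expr1n expr0.
    rewrite exprS IH (sS k); have := sp k.+1; move: (s k.+1) => t t0.
    by field; rewrite gt_eqF.
  have := sp n; move: (s n) => t t0.
  rewrite le_eqVlt; apply/orP; left; apply/eqP; field.
  by rewrite gt_eqF.
have I0 : I 0%N (a, c) = normc (rect_integral a b c d f).
  by rewrite /I sz /= !mulr1 wE0 hE0.
apply: eq0_normc; apply/eqP; rewrite eq_le normc_ge0 andbT -I0.
apply/ler_addgt0Pr => e e0; rewrite add0r.
have K0 : 0 < 4 * (w + h) ^+ 2 + 1 by have := sqr_ge0 (w + h); lra.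
apply: (le_trans (small (e / (4 * (w + h) ^+ 2 + 1)) _)); first by rewrite divr_gt0.
rewrite mulrAC ler_pdivrMr// ler_pM2l//; lra.
Qed.

End Goursat.

(** * Isolated singularities inside a rectangle *)

Section Cauchy.
Context {R : realType}.
Implicit Types (a b c d x y r s : R) (f g : R[i]^o -> R[i]^o).

Definition holomorphic_off_point a b c d x0 y0 f : Prop :=
  forall x y, a <= x <= b -> c <= y <= d -> (x != x0) || (y != y0) ->
    derivable f (x +i* y) 1.

(** What is left of the rectangle when the central square is removed splits into four
rectangles that avoid the singularity. *)
Lemma rect_integral_shrink a b c d x0 y0 s f : 0 < s ->
  a <= x0 - s -> x0 + s <= b -> c <= y0 - s -> y0 + s <= d ->
  holomorphic_off_point a b c d x0 y0 f ->
  rect_integral a b c d f =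
  rect_integral (x0 - s) (x0 + s) (y0 - s) (y0 + s) f.
Proof.
move=> s0 ax bx cy dy hf.
have off_x x : (x < x0) || (x0 < x) -> x != x0.
  by case/orP => ?; [rewrite lt_eqF | rewrite gt_eqF].
have off_y x : (x < y0) || (y0 < x) -> x != y0.
  by case/orP => ?; [rewrite lt_eqF | rewrite gt_eqF].
have ih u v y : a <= u -> v <= b -> c <= y <= d -> (y < y0) || (y0 < y) ->
    cintegrable u v (fun x => f (x +i* y)).
  move=> au vb cyd yy; apply: cintegrable_hseg => x /andP[ux xv].
  apply: hf => //; last by rewrite orbC off_y.
  by rewrite (le_trans au)// (le_trans xv).
have iv u v x : c <= u -> v <= d -> a <= x <= b -> (x < x0) || (x0 < x) ->
    cintegrable u v (fun y => f (x +i* y)).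
  move=> au vb cyd yy; apply: cintegrable_vseg => y /andP[ux xv].
  apply: hf => //; last by rewrite off_x.
  by rewrite (le_trans au)// (le_trans xv).
have xl : x0 - s < x0 by lra.
have xr : x0 < x0 + s by lra.
have yl : y0 - s < y0 by lra.
have yr : y0 < y0 + s by lra.
have ax0 := le_lt_trans ax xl. have xb0 := lt_le_trans xr bx.
have cy0 := le_lt_trans cy yl. have yd0 := lt_le_trans yr dy.
have ab := ltW (lt_trans ax0 xb0). have cd := ltW (lt_trans cy0 yd0).
have zero u1 u2 v1 v2 : a <= u1 -> u1 <= u2 -> u2 <= b -> c <= v1 -> v1 <= v2 ->
    v2 <= d -> (forall x y, u1 <= x <= u2 -> v1 <= y <= v2 -> (x != x0) || (y != y0)) ->
    rect_integral u1 u2 v1 v2 f = 0.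
  move=> H1 H2 H3 H4 H5 H6 H; apply: goursat => // x y xu yv.
  apply: hf; [| |exact: H]; apply/andP; move: xu yv => /andP[? ?] /andP[? ?]; split; lra.
rewrite (@rect_integral_vsplit _ (y0 - s)); first last.
- by apply: iv; rewrite ?lexx ?ab ?ax0.
- by apply: iv; rewrite ?lexx ?ab ?xb0 ?orbT.
- by rewrite cy; lra.
rewrite zero ?add0r//; first last.
- by move=> x y _ /andP[_ yv]; rewrite orbC off_y//; apply/orP; left; exact: le_lt_trans yl.
- by lra.
rewrite (@rect_integral_vsplit _ (y0 + s)); first last.
- by apply: iv; rewrite ?lexx ?ab ?ax0.
- by apply: iv; rewrite ?lexx ?ab ?xb0 ?orbT.
- by rewrite dy andbT; lra.
rewrite [X in _ + X]zero ?addr0//; first last.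
- by move=> x y _ /andP[yv _]; rewrite orbC off_y//; apply/orP; right; exact: lt_le_trans yv.
- by lra.
rewrite (@rect_integral_hsplit _ (x0 - s)); first last.
- by apply: ih; rewrite ?lexx ?yr ?orbT// dy andbT; lra.
- by apply: ih; rewrite ?lexx ?yl// cy; lra.
- by rewrite ax; lra.
rewrite zero ?add0r//; first last.
- by move=> x y /andP[_ yv] _; rewrite off_x//; apply/orP; left; exact: le_lt_trans xl.
- by lra.
- by lra.
rewrite (@rect_integral_hsplit _ (x0 + s)); first last.
- by apply: ih; rewrite ?lexx ?yr ?orbT// dy andbT; lra.
- by apply: ih; rewrite ?lexx ?yl// cy; lra.
- by rewrite bx andbT; lra.
rewrite [X in _ + X]zero ?addr0//; first last.
- by move=> x y /andP[yv _] _; rewrite off_x//; apply/orP; right; exact: lt_le_trans yv.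
- by lra.
by lra.
Qed.

Lemma holomorphic_off_rect_integrable a b c d x0 y0 f : a < x0 < b -> c < y0 < d ->
  holomorphic_off_point a b c d x0 y0 f -> rect_integrable a b c d f.
Proof.
move=> /andP[ax xb] /andP[cy yd] hf.
have ab := ltW (lt_trans ax xb). have cd := ltW (lt_trans cy yd).
split; [apply: cintegrable_hseg|apply: cintegrable_hseg|
  apply: cintegrable_vseg|apply: cintegrable_vseg] => u uab;
  by apply: hf; rewrite ?lexx ?ab ?cd// ?(lt_eqF ax) ?(lt_eqF cy) ?(gt_eqF xb)
    ?(gt_eqF yd) ?orbT.
Qed.

(** On the boundary of the square of half-side [s] around the point, the function is at most
[e / s] for small [s], whereas the perimeter is [8 s]. *)
Lemma rect_integral_removable a b c d x0 y0 f : a < x0 < b -> c < y0 < d ->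
  holomorphic_off_point a b c d x0 y0 f ->
  tends_at (fun z => (z - (x0 +i* y0)) * f z) (x0 +i* y0) 0 ->
  rect_integral a b c d f = 0.
Proof.
move=> /andP[ax xb] /andP[cy yd] hf f0.
apply: eq0_normc; apply/eqP; rewrite eq_le normc_ge0 andbT.
apply/ler_addgt0Pr => e e0; rewrite add0r.
have e16 : 0 < e / 16 by rewrite divr_gt0.
have [r r0 rP] := f0 _ e16.
have [s s0 [s1 s2 s3 s4 s5]] : exists2 s, 0 < s &
    [/\ a <= x0 - s, x0 + s <= b, c <= y0 - s, y0 + s <= d & 2 * s < r].
  pose s := Num.min (r / 4) (Num.min (Num.min (x0 - a) (b - x0)) (Num.min (y0 - c) (d - y0))).
  have sP : [/\ s <= r / 4, s <= x0 - a, s <= b - x0, s <= y0 - c & s <= d - y0].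
    by rewrite /s !ge_min !lexx ?orbT.
  exists s; first by rewrite /s !lt_min !subr_gt0 ax xb cy yd divr_gt0.
  by case: sP => ? ? ? ? ?; split; lra.
rewrite (rect_integral_shrink s0 s1 s2 s3 s4 hf).
have hs : holomorphic_off_point (x0 - s) (x0 + s) (y0 - s) (y0 + s) x0 y0 f.
  by move=> x y /andP[? ?] /andP[? ?]; apply: hf; apply/andP; split; lra.
have side x y : `|x - x0| <= s -> `|y - y0| <= s ->
    (`|x - x0| = s \/ `|y - y0| = s) -> normc (f (x +i* y)) <= e / 16 / s.
  move=> xs ys xys.
  have nE : normc (x +i* y - x0 +i* y0) <= 2 * s.
    by apply: (le_trans (normc_le _)); rewrite /=; lra.
  have ns : s <= normc (x +i* y - x0 +i* y0).
    by case: xys => <-; [exact: (le_Re_normc (x +i* y - x0 +i* y0)) |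
                         exact: (le_Im_normc (x +i* y - x0 +i* y0))].
  have n0 : x +i* y != x0 +i* y0.
    by rewrite -subr_eq0 -normc_gt0; exact: lt_le_trans ns.
  have := rP _ (le_lt_trans nE s5) n0; rewrite subr0 normcM => H.
  rewrite ler_pdivlMr//; apply: le_trans H; rewrite mulrC.
  by apply: ler_wpM2r => //; exact: normc_ge0.
have mid u u0 : u0 - s <= u <= u0 + s -> `|u - u0| <= s.
  by move=> /andP[? ?]; rewrite ler_norml; apply/andP; split; lra.
have dm u0 : `|u0 - s - u0| = s by rewrite addrAC subrr add0r normrN gtr0_norm.
have dp u0 : `|u0 + s - u0| = s by rewrite addrAC subrr add0r gtr0_norm.
have ls : x0 - s <= x0 + s by lra.
have lt : y0 - s <= y0 + s by lra.
have ib : rect_integrable (x0 - s) (x0 + s) (y0 - s) (y0 + s) f.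
  by apply: holomorphic_off_rect_integrable hs; apply/andP; split; lra.
apply: (le_trans (rect_integral_bound (M := e / 16 / s) ls lt ib _ _ _ _)).
- by move=> x xs; apply: side; rewrite ?dm//; [exact: mid | right].
- by move=> x xs; apply: side; rewrite ?dp//; [exact: mid | right].
- by move=> y ys; apply: side; rewrite ?dp//; [exact: mid | left].
- by move=> y ys; apply: side; rewrite ?dm//; [exact: mid | left].
rewrite le_eqVlt; apply/orP; left; apply/eqP; field.
by rewrite gt_eqF.
Qed.

End Cauchy.

(** * Cauchy's estimate *)

Section CauchyEstimate.
Context {R : realType}.
Implicit Types (a b c d x y r s : R) (f g : R[i]^o -> R[i]^o).

Lemma derivable_inv_shift (z0 z : R[i]) : z != z0 ->
  derivable (fun w : R[i]^o => (w - z0)^-1 : R[i]^o) z 1.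
Proof.
move=> zz0; apply: (@derivableV _ _ (fun w : R[i]^o => w - z0)).
  by rewrite subr_eq0.
by apply: derivableB; [exact: derivable_id | exact: derivable_cst].
Qed.

Lemma Re_inv x y : Re (x +i* y)^-1 = x / (x ^+ 2 + y ^+ 2).
Proof. by []. Qed.

Lemma Im_inv x y : Im (x +i* y)^-1 = - y / (x ^+ 2 + y ^+ 2).
Proof. by rewrite mulNr. Qed.

Lemma Rintegral_ge a b (u : R -> R) (k : R) : a <= b ->
  (@lebesgue_measure R).-integrable `[a, b] (EFin \o u) ->
  (forall x, a <= x <= b -> k <= u x) ->
  k * (b - a) <= \int[@lebesgue_measure R]_(x in `[a, b]) u x.
Proof.
move=> ab iu ku.
rewrite -(Rintegral_itv_cst k ab); apply: le_Rintegral => //.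
  exact: integrable_itv_cst.
Qed.

(** The exact value is [2 pi i], but a lower bound of the modulus suffices later. Every side
contributes to the imaginary part the integral of a positive function, at least [1 / 4]
because no side is closer than [r / 2] or farther than [r]. *)
Lemma rect_integral_inv_ge1 a b c d x0 y0 r : 0 < r ->
  r / 2 <= x0 - a <= r -> r / 2 <= b - x0 <= r ->
  r / 2 <= y0 - c <= r -> r / 2 <= d - y0 <= r ->
  1 <= normc (rect_integral a b c d (fun z => (z - (x0 +i* y0))^-1)).
Proof.
move=> r0 /andP[xa1 xa2] /andP[xb1 xb2] /andP[yc1 yc2] /andP[yd1 yd2].
set k := fun z : R[i]^o => _.
have [ax xb cy yd] : [/\ a < x0, x0 < b, c < y0 & y0 < d] by split; lra.
have [i1 i2 i3 i4] : rect_integrable a b c d k.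
  apply: (@holomorphic_off_rect_integrable _ a b c d x0 y0); rewrite ?ax ?xb ?cy ?yd//.
  move=> x y _ _ xy; apply: derivable_inv_shift.
  by rewrite eq_complex negb_and.
have kE x y : k (x +i* y) = ((x - x0) +i* (y - y0))^-1 by [].
(* [p] is the distance of the side to the centre and [q] the coordinate along it. *)
have sidebound p q : r / 2 <= p <= r -> `|q| <= r -> (4 * r)^-1 <= p / (p ^+ 2 + q ^+ 2).
  move=> /andP[p1 p2]; rewrite ler_norml => /andP[q1 q2].
  rewrite ler_pdivlMr; last by nra.
  rewrite mulrC ler_pdivrMr; [nra | lra].
have mem u u0 lo hi : u0 - lo <= r -> hi - u0 <= r -> lo <= u <= hi -> `|u - u0| <= r.
  by move=> ? ? /andP[? ?]; rewrite ler_norml; apply/andP; split; lra.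
have ab : a <= b by lra. have cd : c <= d by lra.
have B1 := Rintegral_ge ab i1.2 (k := (4 * r)^-1).
have B2 := Rintegral_ge cd i3.1 (k := (4 * r)^-1).
have iN u v (h : R -> R) : (@lebesgue_measure R).-integrable `[u, v] (EFin \o h) ->
    (@lebesgue_measure R).-integrable `[u, v] (EFin \o (fun x => - h x)).
  by move=> ih; apply: eq_integrable (integrableN ih) => //.
have NE u v (h : R -> R) : (@lebesgue_measure R).-integrable `[u, v] (EFin \o h) ->
   \int[@lebesgue_measure R]_(x in `[u, v]) (- h x) =
   - \int[@lebesgue_measure R]_(x in `[u, v]) h x.
  move=> ih; rewrite -[RHS]mulN1r -RintegralZl//.
  by apply: eq_Rintegral => x _; rewrite mulN1r.
have B3 := Rintegral_ge ab (iN _ _ _ i2.2) (k := (4 * r)^-1).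
have B4 := Rintegral_ge cd (iN _ _ _ i4.1) (k := (4 * r)^-1).
rewrite NE in B3; last exact: i2.2.
rewrite NE in B4; last exact: i4.1.
apply: le_trans (le_Im_normc _).
apply: le_trans (ler_norm _).
have -> : Im (rect_integral a b c d k) =
   Im (cintegral a b (fun x => k (x +i* c))) - Im (cintegral a b (fun x => k (x +i* d)))
   + (Re (cintegral c d (fun y => k (b +i* y))) - Re (cintegral c d (fun y => k (a +i* y)))).
  rewrite /rect_integral; do 4 case: (cintegral _ _ _) => ? ?.
  by rewrite /=; ring.
have C1 : (4 * r)^-1 * (b - a) <= Im (cintegral a b (fun x => k (x +i* c))).
  apply: B1 => x xab; rewrite kE Im_inv opprB addrC [X in _ <= _ / X]addrC.
  rewrite -[(c - y0) ^+ 2]sqrrN opprB addrC.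
  apply: sidebound; first by rewrite yc1. exact: mem xab.
have C3 : (4 * r)^-1 * (b - a) <= - Im (cintegral a b (fun x => k (x +i* d))).
  apply: B3 => x xab; rewrite kE Im_inv mulNr opprK [X in _ <= _ / X]addrC.
  apply: sidebound; first by rewrite yd1. exact: mem xab.
have C2 : (4 * r)^-1 * (d - c) <= Re (cintegral c d (fun y => k (b +i* y))).
  apply: B2 => x xab; rewrite kE Re_inv.
  apply: sidebound; first by rewrite xb1. exact: mem xab.
have C4 : (4 * r)^-1 * (d - c) <= - Re (cintegral c d (fun y => k (a +i* y))).
  apply: B4 => x xab; rewrite kE Re_inv -mulNr opprB.
  rewrite -[(a - x0) ^+ 2]sqrrN opprB.
  apply: sidebound; first by rewrite xa1. exact: mem xab.
have q1 : 4^-1 <= (4 * r)^-1 * (b - a).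
  by rewrite mulrC ler_pdivlMr; move: xa1 xb1 r0; clear; lra.
have q2 : 4^-1 <= (4 * r)^-1 * (d - c).
  by rewrite mulrC ler_pdivlMr; move: yc1 yd1 r0; clear; lra.
move: q1 q2 C1 C2 C3 C4; clear.
move: (Im _) (Im _) (Re _) (Re _) (_ * _) (_ * _) => *; lra.
Qed.

(** Subtracting [l / (z - z0)] leaves a removable singularity, so the integral of [f] is [l]
times that of [1 / (z - z0)], whose modulus is at least 1. *)
Lemma residue_le a b c d x0 y0 r f (l : R[i]) : 0 < r ->
  r / 2 <= x0 - a <= r -> r / 2 <= b - x0 <= r ->
  r / 2 <= y0 - c <= r -> r / 2 <= d - y0 <= r ->
  holomorphic_off_point a b c d x0 y0 f ->
  tends_at (fun z => (z - (x0 +i* y0)) * f z) (x0 +i* y0) l ->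
  normc l <= normc (rect_integral a b c d f).
Proof.
move=> r0 xa xb yc yd hf fl.
have k1 := rect_integral_inv_ge1 r0 xa xb yc yd.
have [axb cyd] : a < x0 < b /\ c < y0 < d.
  move: xa xb yc yd => /andP[? _] /andP[? _] /andP[? _] /andP[? _].
  by split; apply/andP; split; lra.
set k := fun z : R[i]^o => _ in k1.
have hk : holomorphic_off_point a b c d x0 y0 k.
  move=> x y _ _ xy; apply: derivable_inv_shift.
  by rewrite eq_complex negb_and.
pose lk : R[i]^o -> R[i]^o := fun z => - l * k z.
have hlk : holomorphic_off_point a b c d x0 y0 lk.
  move=> x y xab ycd xy.
  exact: (derivableM (@derivable_cst _ _ _ (- l : R[i]^o) _ _) (hk x y xab ycd xy)).
have hs : holomorphic_off_point a b c d x0 y0 (f + lk).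
  by move=> x y xab ycd xy; exact: (derivableD (hf x y xab ycd xy) (hlk x y xab ycd xy)).
have s0 : tends_at (fun z => (z - (x0 +i* y0)) * (f + lk) z) (x0 +i* y0) 0.
  move=> e /fl[t t0 tP]; exists t => // w wt wz; have := tP w wt wz.
  rewrite (_ : _ - 0 = (w - (x0 +i* y0)) * f w - l)//.
  rewrite subr0 -[(f + lk) w]/(f w + - l * (w - _)^-1) mulrDr mulrCA divff ?mulr1//.
  by rewrite subr_eq0.
have := rect_integral_removable axb cyd hs s0.
have i1 := holomorphic_off_rect_integrable axb cyd hf.
have i2 := holomorphic_off_rect_integrable axb cyd hlk.
have i3 := holomorphic_off_rect_integrable axb cyd hk.
rewrite (rect_integralD i1 i2) (rect_integralZ (- l) i3) mulNr => /eqP.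
rewrite subr_eq0 => /eqP ->; rewrite normcM ler_peMr// normc_ge0//.
Qed.

(** Residue of [(f z - f z0) / (z - z0) ^+ 2] at [z0]. *)
Lemma derive1_le_sup x0 y0 r f M : 0 < r ->
  (forall x y, `|x - x0| <= r -> `|y - y0| <= r ->
     derivable f (x +i* y) 1 /\ normc (f (x +i* y)) <= M) ->
  normc (derive1 f (x0 +i* y0)) <= 32 * M / r.
Proof.
move=> r0 fr; set z0 := x0 +i* y0.
have zz : `|x0 - x0| <= r /\ `|y0 - y0| <= r by rewrite !subrr normr0 ltW.
have [df0 fM0] := fr x0 y0 zz.1 zz.2.
pose h : R[i]^o -> R[i]^o := fun z => (f z - f z0) * ((z - z0)^-1 * (z - z0)^-1).
have mid u u0 : u0 - r <= u <= u0 + r -> `|u - u0| <= r.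
  by move=> /andP[? ?]; rewrite ler_norml; apply/andP; split; lra.
have hh : holomorphic_off_point (x0 - r) (x0 + r) (y0 - r) (y0 + r) x0 y0 h.
  move=> x y xr yr xy; have [dfx _] := fr x y (mid _ _ xr) (mid _ _ yr).
  have zn : (x +i* y) != z0 by rewrite eq_complex negb_and.
  have di := derivable_inv_shift zn.
  exact: (derivableM (derivableB dfx (@derivable_cst _ _ _ (f z0) _ _)) (derivableM di di)).
have ht : tends_at (fun z => (z - z0) * h z) z0 (derive1 f z0).
  move=> e /(derivable_tends df0)[t t0 tP]; exists t => // w wt wz.
  have := tP w wt wz; rewrite (_ : (f w - f z0) / (w - z0) = (w - z0) * h w)//.
  by rewrite /h; field; rewrite subr_eq0.
have e1 u : r / 2 <= u - (u - r) <= r by apply/andP; split; lra.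
have e2 u : r / 2 <= (u + r) - u <= r by apply/andP; split; lra.
have l1 u : u - r <= u + r by lra.
apply: (le_trans (residue_le r0 (e1 x0) (e2 x0) (e1 y0) (e2 y0) hh ht)).
have e3 u : u - r < u < u + r by apply/andP; split; lra.
have ih := holomorphic_off_rect_integrable (e3 x0) (e3 y0) hh.
have side x y : `|x - x0| <= r -> `|y - y0| <= r ->
    (`|x - x0| = r \/ `|y - y0| = r) -> normc (h (x +i* y)) <= 2 * M / r ^+ 2.
  move=> xs ys xys; have [_ fM] := fr x y xs ys.
  have ns : r <= normc (x +i* y - z0).
    by case: xys => <-; [exact: (le_Re_normc (x +i* y - x0 +i* y0)) |
                         exact: (le_Im_normc (x +i* y - x0 +i* y0))].
  have np : 0 < normc (x +i* y - z0) by exact: lt_le_trans ns.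
  rewrite /h !normcM !normcV -invfM -expr2; apply: ler_pM.
  - exact: normc_ge0.
  - by rewrite invr_ge0 exprn_ge0// normc_ge0.
  - apply: (le_trans (le_normcD _ _)); rewrite normcN mulr_natl mulr2n; exact: lerD.
  - by rewrite lef_pV2 ?posrE ?exprn_gt0// ler_pXn2r// nnegrE ltW.
have dm u0 : `|u0 - r - u0| = r by rewrite addrAC subrr add0r normrN gtr0_norm.
have dp u0 : `|u0 + r - u0| = r by rewrite addrAC subrr add0r gtr0_norm.
apply: (le_trans (rect_integral_bound (M := 2 * M / r ^+ 2) (l1 x0) (l1 y0) ih _ _ _ _)).
- by move=> x xs; apply: side; rewrite ?dm//; [exact: mid | right].
- by move=> x xs; apply: side; rewrite ?dp//; [exact: mid | right].
- by move=> y ys; apply: side; rewrite ?dp//; [exact: mid | left].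
- by move=> y ys; apply: side; rewrite ?dm//; [exact: mid | left].
rewrite le_eqVlt; apply/orP; left; apply/eqP; field.
by rewrite gt_eqF.
Qed.

End CauchyEstimate.

(** * Measurability in the plane *)

Section PlaneMeasurability.
Context {R : realType}.
Notation plane := (measurableTypeR R * measurableTypeR R)%type.
Implicit Types (A D : set plane) (f : R[i]^o -> R[i]^o).

Definition cplx (w : plane) : R[i] := w.1 +i* w.2.

(** Openness for the sup norm, which is tied to rectangles, the generators of the product
sigma-algebra. *)
Definition box_open A : Prop := forall w, A w -> exists2 e : R, 0 < e &
  forall v : plane, `|v.1 - w.1| < e -> `|v.2 - w.2| < e -> A v.

(** The set is the union of the countably many rectangles with rational sides that it
contains. *)
Lemma box_open_measurable A : box_open A -> measurable A.
Proof.
move=> oA.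
pose box (q : (rat * rat) * (rat * rat)) : set plane :=
  [set` `]ratr q.1.1, (ratr q.1.2 : R)[] `*` [set` `]ratr q.2.1, (ratr q.2.2 : R)[].
have mbox q : measurable (box q) by apply: measurableX; exact: measurable_itv.
rewrite (_ : A = \bigcup_q (if `[< box q `<=` A >] then box q else set0)); last first.
  apply/seteqP; split => [w Aw|w [q _]]; last by case: asboolP => // /[apply].
  have [e e0 eA] := oA w Aw.
  have near (x : R) : exists p q : rat, [/\ ratr p < x, x < ratr q &
      forall y, ratr p < y < ratr q -> `|y - x| < e].
    have /rat_in_itvoo[p /[!in_itv]/= /andP[p1 p2]] : x - e < x by lra.
    have /rat_in_itvoo[q /[!in_itv]/= /andP[q1 q2]] : x < x + e by lra.
    exists p, q; split => // y /andP[y1 y2]; rewrite ltr_norml.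
    by apply/andP; split; lra.
  have [p1 [q1 [pw1 qw1 H1]]] := near w.1.
  have [p2 [q2 [pw2 qw2 H2]]] := near w.2.
  exists ((p1, q1), (p2, q2)) => //; case: asboolP => [_|].
    by split; rewrite /= in_itv/=; apply/andP.
  by case=> v [] /=; rewrite !in_itv /= => v1 v2; apply: eA; [exact: H1|exact: H2].
by apply: countable_bigcupT_measurable => // q; case: asboolP.
Qed.

Lemma box_open_measurable_fun D (u : plane -> R) : box_open D ->
  (forall w, D w -> forall e : R, 0 < e -> exists2 d : R, 0 < d &
    forall v : plane, `|v.1 - w.1| < d -> `|v.2 - w.2| < d -> `|u v - u w| <= e) ->
  measurable_fun D u.
Proof.
move=> oD cu; apply: (measurability _ (RGenOInfty.measurableE R)) => //.
move=> /= _ [_ [x ->] <-]; apply: box_open_measurable => w [Dw].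
rewrite /= in_itv/= andbT => xu; have [e1 e10 H1] := oD w Dw.
have [|e2 e20 H2] := cu w Dw ((u w - x) / 2); first by rewrite divr_gt0// subr_gt0.
exists (Num.min e1 e2); first by rewrite lt_min e10.
move=> v; rewrite !lt_min => /andP[a1 a2] /andP[b1 b2]; split; first exact: H1.
have := H2 v a2 b2; rewrite ler_norml => /andP[c1 c2].
by rewrite /= in_itv/= andbT; lra.
Qed.

Definition plane_disc : set plane := [set w | unit_disc (w.1 +i* w.2)].

Lemma plane_disc_open : box_open plane_disc.
Proof.
move=> w /unit_discE w1; exists ((1 - normc (cplx w)) / 2).
  by rewrite divr_gt0// subr_gt0.
move=> v v1 v2; apply/unit_discE.
rewrite -[v.1 +i* v.2](subrK (cplx w)); apply: (le_lt_trans (le_normcD _ _)).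
have := normc_le (v.1 +i* v.2 - cplx w); rewrite /=; lra.
Qed.

Lemma measurable_plane_disc : measurable plane_disc.
Proof. exact: box_open_measurable plane_disc_open. Qed.

Lemma measurable_normc (u v : plane -> R) D :
  measurable_fun D u -> measurable_fun D v ->
  measurable_fun D (fun w => normc (u w +i* v w)).
Proof.
move=> mu mv.
rewrite (_ : (fun w => _) = (fun x : R => x `^ 2^-1) \o (fun w => u w ^+ 2 + v w ^+ 2)).
  apply: measurableT_comp; first exact: measurable_powR.
  by apply: measurable_funD; exact: measurable_funX.
by apply/funext => w /=; rewrite powR12_sqrt ?addr_ge0 ?sqr_ge0.
Qed.

(** [f] cut off outside the disc: the values of [f] there are arbitrary, and the
difference quotients below need not be measurable without the cut-off. *)
Definition cutoff f (z : R[i]) : R[i] := if `[< unit_disc z >] then f z else 0.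

Lemma cutoffE f z : unit_disc z -> cutoff f z = f z.
Proof. by rewrite /cutoff; case: asboolP. Qed.

Lemma measurable_cutoff f : holomorphic_on_disc f ->
  measurable_fun setT (fun w : plane => Re (cutoff f (cplx w))) /\
  measurable_fun setT (fun w : plane => Im (cutoff f (cplx w))).
Proof.
move=> hf.
have cont w : plane_disc w -> forall e : R, 0 < e -> exists2 d : R, 0 < d &
    forall v : plane, `|v.1 - w.1| < d -> `|v.2 - w.2| < d ->
      normc (f (cplx v) - f (cplx w)) <= e.
  move=> Dw e e0; have [d d0 dP] := derivable_eps_continuous (hf _ Dw) e0.
  exists (d / 2); first by rewrite divr_gt0.
  move=> v v1 v2; apply: dP; apply: (le_lt_trans (normc_le _)); rewrite /=; lra.
have mRe : measurable_fun plane_disc (fun w => Re (f (cplx w))).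
  apply: box_open_measurable_fun; first exact: plane_disc_open.
  move=> w Dw e e0; have [d d0 dP] := cont w Dw e e0; exists d => // v v1 v2.
  rewrite -raddfB; exact: le_trans (le_Re_normc _) (dP v v1 v2).
have mIm : measurable_fun plane_disc (fun w => Im (f (cplx w))).
  apply: box_open_measurable_fun; first exact: plane_disc_open.
  move=> w Dw e e0; have [d d0 dP] := cont w Dw e e0; exists d => // v v1 v2.
  rewrite -raddfB; exact: le_trans (le_Im_normc _) (dP v v1 v2).
split.
  move/(measurable_restrictT _ measurable_plane_disc) : mRe.
  apply: eq_measurable_fun => w _; rewrite /cutoff /patch.
  by case: asboolP => Dw; [rewrite mem_set|rewrite memNset].
move/(measurable_restrictT _ measurable_plane_disc) : mIm.
apply: eq_measurable_fun => w _; rewrite /cutoff /patch.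
by case: asboolP => Dw; [rewrite mem_set|rewrite memNset].
Qed.

(** The increment is real, so that these difference quotients are controlled by the
derivative along horizontal segments. *)
Definition real_quotient f (n : nat) (z : R[i]) : R[i] :=
  (n.+1%:R%:C) * (cutoff f (z + (n.+1%:R^-1)%:C) - cutoff f z).

Lemma measurable_real_quotient f n : holomorphic_on_disc f ->
  measurable_fun setT (fun w : plane => normc (real_quotient f n (cplx w))).
Proof.
move=> /measurable_cutoff[mR mI].
pose s (w : plane) : plane := (w.1 + n.+1%:R^-1, w.2).
have ms : measurable_fun setT s.
  apply: measurable_fun_pair; last exact: measurable_snd.
  by apply: measurable_funD => //; exact: measurable_fst.
pose u w := n.+1%:R * (Re (cutoff f (cplx (s w))) - Re (cutoff f (cplx w))).
pose v w := n.+1%:R * (Im (cutoff f (cplx (s w))) - Im (cutoff f (cplx w))).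
have mu : measurable_fun setT u.
  apply: measurable_funM => //; apply: measurable_funB => //.
  exact: (measurableT_comp mR ms).
have mv : measurable_fun setT v.
  apply: measurable_funM => //; apply: measurable_funB => //.
  exact: (measurableT_comp mI ms).
apply: eq_measurable_fun (measurable_normc mu mv) => w _.
rewrite /u /v /real_quotient; congr normc.
rewrite (_ : cplx w + _ = cplx (s w)); last first.
  by apply/eqP; rewrite eq_complex /= addr0 !eqxx.
case: (cutoff f _) => a b; case: (cutoff f _) => a' b'.
by apply/eqP; rewrite eq_complex /=; apply/andP; split; apply/eqP; ring.
Qed.

Lemma real_quotient_cvg f z : holomorphic_on_disc f -> unit_disc z ->
  normc (real_quotient f n z) @[n --> \oo] --> normc (derive1 f z).
Proof.
move=> hf Dz; apply/cvgrPdist_le => e e0.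
have [d d0 dP] := derivable_tends (hf z Dz) e0.
have z1 : 0 < 1 - normc z by move/unit_discE : Dz; lra.
have m0 : 0 < Num.min d (1 - normc z) by rewrite lt_min d0.
near=> n.
have nn : (n.+1%:R^-1 : R) < Num.min d (1 - normc z).
  near: n; exact: near_infty_natSinv_lt (PosNum m0).
move: nn; rewrite lt_min => /andP[nd n1].
set h : R := n.+1%:R^-1 in nd n1 *.
have h0 : 0 < h by rewrite invr_gt0.
have nh : normc h%:C = h by rewrite normc_real gtr0_norm.
have Dzh : unit_disc (z + h%:C).
  by apply/unit_discE; apply: (le_lt_trans (le_normcD _ _)); rewrite nh; lra.
have := dP (z + h%:C); rewrite addrAC subrr add0r nh => /(_ nd).
rewrite -subr_eq0 addrAC subrr add0r -normc_gt0 nh => /(_ h0) H.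
rewrite distrC; apply: (le_trans (ler_dist_normc _ _)).
rewrite (_ : real_quotient f n z = (f (z + h%:C) - f z) / h%:C)//.
rewrite /real_quotient -/h !cutoffE// mulrC; congr (_ * _).
by rewrite /h -fmorphV invrK.
Unshelve. all: by end_near. Qed.

Lemma measurable_normc_derive1 f : holomorphic_on_disc f ->
  measurable_fun plane_disc (fun w => normc (derive1 f (w.1 +i* w.2))).
Proof.
move=> hf.
apply: (measurable_fun_cvg (h := fun n w => normc (real_quotient f n (cplx w)))).
  by move=> n; apply: measurable_funTS; exact: measurable_real_quotient.
by move=> w Dw; exact: real_quotient_cvg.
Qed.


End PlaneMeasurability.

(** * The area mean of a holomorphic function *)

Section AreaMean.
Context {R : realType}.
Notation plane := (measurableTypeR R * measurableTypeR R)%type.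
Notation mu := (@lebesgue_measure R).
Implicit Types (a b c d x y r s T : R) (f g : R[i]^o -> R[i]^o).

Lemma cintegral_mul_bound u v (h k : R -> R[i]) m T : 0 <= m ->
  cintegrable u v (fun t => h t * k t) ->
  mu.-integrable `[u, v] (EFin \o (fun t => normc (h t))) ->
  (forall t, u <= t <= v -> normc (k t) <= m) ->
  \int[mu]_(t in `[u, v]) normc (h t) <= T ->
  normc (cintegral u v (fun t => h t * k t)) <= 2 * (m * T).
Proof.
move=> m0 ihk ih km hT; apply: (le_trans (cintegral_norm_le ihk)).
have [i1 i2] := ihk.
have iN : mu.-integrable `[u, v] (EFin \o (fun t => m * normc (h t))).
  exact: integrable_scale.
have NT : \int[mu]_(t in `[u, v]) (m * normc (h t)) <= m * T.
  by rewrite RintegralZl// ler_wpM2l.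
rewrite [leRHS]mulrDl mul1r; apply: lerD; apply: le_trans NT.
  apply: le_Rintegral => //; first exact: integrable_norm.
  move=> t; rewrite /= in_itv/= => tuv; apply: (le_trans (le_Re_normc _)).
  rewrite normcM mulrC; apply: ler_wpM2r; [exact: normc_ge0|exact: km].
apply: le_Rintegral => //; first exact: integrable_norm.
move=> t; rewrite /= in_itv/= => tuv; apply: (le_trans (le_Im_normc _)).
rewrite normcM mulrC; apply: ler_wpM2r; [exact: normc_ge0|exact: km].
Qed.

(** Otherwise the integral over [[u, v]] alone would reach [T * (v - u)]. *)
Lemma exists_below_mean (A : measurableTypeR R -> \bar R) u v T : u < v ->
  measurable_fun setT A -> (forall x, 0 <= A x)%E ->
  (\int[mu]_x A x < (T * (v - u))%:E)%E ->
  exists2 x, u <= x <= v & (A x < T%:E)%E.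
Proof.
move=> uv mA A0; apply: contraPP => nA; apply/negP; rewrite -leNgt.
have AT x : u <= x <= v -> (T%:E <= A x)%E.
  by move=> xuv; rewrite leNgt; apply/negP => Ax; apply: nA; exists x.
have [T0|/ltW T0] := lerP T 0.
  apply: (@le_trans _ _ 0%E); last exact: integral_ge0.
  by rewrite lee_fin; apply: mulr_le0_ge0 => //; rewrite subr_ge0 ltW.
have -> : (T * (v - u))%:E = (\int[mu]_(x in `[u, v]) (cst T%:E) x)%E.
  by rewrite integral_cst//= lebesgue_measure_itv/= lte_fin uv EFinM.
apply: (@le_trans _ _ (\int[mu]_(x in `[u, v]) A x)%E).
  apply: ge0_le_integral => //; first by apply: measurable_funTS.
apply: ge0_subset_integral => //.
Qed.

Definition square x0 y0 r : set plane :=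
  `[x0 - r, x0 + r] `*` `[y0 - r, y0 + r].

Lemma measurable_square x0 y0 r : measurable (square x0 y0 r).
Proof. by apply: measurableX; exact: measurable_itv. Qed.

Lemma integrable_normc_hseg a b y f :
  (forall x, a <= x <= b -> derivable f (x +i* y) 1) ->
  mu.-integrable `[a, b] (EFin \o (fun x => normc (f (x +i* y)))).
Proof.
move=> df; apply: continuous_compact_integrable; first exact: segment_compact.
apply: within_continuous_eps => x xab e e0.
have [d d0 dP] := derivable_eps_continuous (df x xab) e0.
exists d => // x' xd; apply: (le_trans (ler_dist_normc _ _)); apply: dP.
apply: le_lt_trans xd.
by apply: (le_trans (normc_le _)); rewrite /= subrr normr0 addr0.
Qed.

Lemma integrable_normc_vseg x c d f :
  (forall y, c <= y <= d -> derivable f (x +i* y) 1) ->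
  mu.-integrable `[c, d] (EFin \o (fun y => normc (f (x +i* y)))).
Proof.
move=> df; apply: continuous_compact_integrable; first exact: segment_compact.
apply: within_continuous_eps => y xab e e0.
have [t d0 dP] := derivable_eps_continuous (df y xab) e0.
exists t => // x' xd; apply: (le_trans (ler_dist_normc _ _)); apply: dP.
apply: le_lt_trans xd.
by apply: (le_trans (normc_le _)); rewrite /= subrr normr0 add0r.
Qed.

(** The four sides of the rectangle are chosen in the outer bands of the square, at distance
between [r / 2] and [r] of the centre, by [exists_below_mean] applied to the integrals of
[|g|] along vertical and horizontal lines: each is below [T]. The residue of
[g z / (z - z0)] is [g z0], and [1 / (z - z0)] is at most [2 / r] on the sides. *)
Lemma area_mean x0 y0 r g T : 0 < r ->
  holomorphic_on_rect (x0 - r) (x0 + r) (y0 - r) (y0 + r) g ->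
  measurable_fun (square x0 y0 r) (fun w => normc (g (cplx w))) ->
  (\int[mu \x mu]_(w in square x0 y0 r) (normc (g (cplx w)))%:E < (T * (r / 2))%:E)%E ->
  normc (g (x0 +i* y0)) <= 16 * T / r.
Proof.
move=> r0 hg mg intT.
have sub u u0 v1 v2 : u0 - r <= v1 -> v2 <= u0 + r -> v1 <= u <= v2 -> u0 - r <= u <= u0 + r.
  by clear; move=> ? ? /andP[? ?]; apply/andP; split; lra.
pose G (w : plane) : \bar R := ((EFin \o (fun w => normc (g (cplx w)))) \_ (square x0 y0 r)) w.
have mG : measurable_fun setT G.
  apply/(measurable_restrictT _ (measurable_square x0 y0 r)).
  exact/measurable_EFinP.
have G0 w : (0 <= G w)%E.
  by rewrite /G /patch; case: ifP => // _; rewrite lee_fin normc_ge0.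
have GE x y : x0 - r <= x <= x0 + r -> y0 - r <= y <= y0 + r ->
    G (x, y) = (normc (g (x +i* y)))%:E.
  move=> xr yr; have sq : square x0 y0 r (x, y) by split; rewrite /= in_itv.
  by rewrite /G /patch mem_set.
have I1 : (\int[mu]_x fubini_F mu G x < (T * (r / 2))%:E)%E.
  by move: intT; rewrite integral_mkcond (fubini_tonelli1 G mG G0).
have I2 : (\int[mu]_x fubini_G mu G x < (T * (r / 2))%:E)%E.
  by move: intT; rewrite integral_mkcond (fubini_tonelli2 G mG G0).
have mF : measurable_fun setT (fubini_F mu G) by exact: measurable_fun_fubini_tonelli_F.
have mG' : measurable_fun setT (fubini_G mu G) by exact: measurable_fun_fubini_tonelli_G.
have F0 x : (0 <= fubini_F mu G x)%E by apply: integral_ge0.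
have H0 x : (0 <= fubini_G mu G x)%E by apply: integral_ge0.
have pick (A : measurableTypeR R -> \bar R) u :
    measurable_fun setT A -> (forall x, 0 <= A x)%E ->
    (\int[mu]_x A x < (T * (r / 2))%:E)%E ->
    exists2 x, u <= x <= u + r / 2 & (A x < T%:E)%E.
  move=> mA A0 AT; apply: exists_below_mean => //; last by rewrite addrAC subrr add0r.
  by rewrite ltrDl divr_gt0.
have [a /andP[a1 a2] aT] := pick _ (x0 - r) mF F0 I1.
have [b /andP[b1 b2] bT] := pick _ (x0 + r / 2) mF F0 I1.
have [c /andP[c1 c2] cT] := pick _ (y0 - r) mG' H0 I2.
have [d /andP[d1 d2] dT] := pick _ (y0 + r / 2) mG' H0 I2.
have vT x u v : x0 - r <= x <= x0 + r -> y0 - r <= u -> v <= y0 + r ->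
    (fubini_F mu G x < T%:E)%E -> \int[mu]_(y in `[u, v]) normc (g (x +i* y)) <= T.
  move=> xr ur vr xT.
  have ig : mu.-integrable `[u, v] (EFin \o (fun y => normc (g (x +i* y)))).
    by apply: integrable_normc_vseg => y yuv; apply: hg => //; exact: sub yuv.
  rewrite -lee_fin /Rintegral fineK; last exact: (integrable_fin_num _ ig).
  apply: le_trans (ltW xT); rewrite /fubini_F.
  apply: (@le_trans _ _ (\int[mu]_(y in `[u, v]) G (x, y))%E).
    rewrite le_eqVlt; apply/orP; left; apply/eqP; apply: eq_integral => y.
    rewrite inE /= in_itv/= => yuv; rewrite GE//; exact: sub yuv.
  apply: ge0_subset_integral => //.
  exact: (measurableT_comp mG (pair1_measurable x)).
have hT y u v : y0 - r <= y <= y0 + r -> x0 - r <= u -> v <= x0 + r ->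
    (fubini_G mu G y < T%:E)%E -> \int[mu]_(x in `[u, v]) normc (g (x +i* y)) <= T.
  move=> xr ur vr xT.
  have ig : mu.-integrable `[u, v] (EFin \o (fun x => normc (g (x +i* y)))).
    by apply: integrable_normc_hseg => x xuv; apply: hg => //; exact: sub xuv.
  rewrite -lee_fin /Rintegral fineK; last exact: (integrable_fin_num _ ig).
  apply: le_trans (ltW xT); rewrite /fubini_G.
  apply: (@le_trans _ _ (\int[mu]_(x in `[u, v]) G (x, y))%E).
    rewrite le_eqVlt; apply/orP; left; apply/eqP; apply: eq_integral => x.
    rewrite inE /= in_itv/= => yuv; rewrite GE//; exact: sub yuv.
  apply: ge0_subset_integral => //.
  exact: (measurableT_comp mG (pair2_measurable y)).
set z0 := x0 +i* y0.
pose k : R[i]^o -> R[i]^o := fun z => (z - z0)^-1.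
pose h : R[i]^o -> R[i]^o := fun z => g z * k z.
have c2' : c <= y0 - r / 2 by clear -c2; lra.
have a2' : a <= x0 - r / 2 by clear -a2; lra.
have b2' : b <= x0 + r by clear -b2; lra.
have d2' : d <= y0 + r by clear -d2; lra.
have hh : holomorphic_off_point a b c d x0 y0 h.
  move=> x y xab ycd xy.
  have dg : derivable g (x +i* y) 1.
    by apply: hg; [exact: sub xab | exact: sub ycd].
  have dk : derivable k (x +i* y) 1.
    by apply: derivable_inv_shift; rewrite eq_complex negb_and.
  exact: (derivableM dg dk).
have dz0 : derivable g z0 1 by apply: hg; clear -r0; apply/andP; split; lra.
have ht : tends_at (fun z => (z - z0) * h z) z0 (g z0).
  move=> e e0; have [t t0 tP] := derivable_eps_continuous dz0 e0.
  exists t => // w wt wz; rewrite /h /k mulrCA divff ?mulr1 ?subr_eq0//.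
  exact: tP.
have xa : r / 2 <= x0 - a <= r by clear -r0 a1 a2; apply/andP; split; lra.
have xb : r / 2 <= b - x0 <= r by clear -r0 b1 b2; apply/andP; split; lra.
have yc : r / 2 <= y0 - c <= r by clear -r0 c1 c2; apply/andP; split; lra.
have yd : r / 2 <= d - y0 <= r by clear -r0 d1 d2; apply/andP; split; lra.
apply: (le_trans (residue_le r0 xa xb yc yd hh ht)).
have [axb cyd] : a < x0 < b /\ c < y0 < d.
  by clear -r0 a2 b1 c2 d1; split; apply/andP; split; lra.
have [i1 i2 i3 i4] := holomorphic_off_rect_integrable axb cyd hh.
have kb x y : (r / 2 <= `|x - x0|) || (r / 2 <= `|y - y0|) -> normc (k (x +i* y)) <= 2 / r.
  move=> xy; rewrite /k normcV -[2 / r]invf_div lef_pV2 ?posrE ?divr_gt0//.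
    case/orP: xy => /le_trans; apply; first exact: (le_Re_normc (x +i* y - z0)).
    exact: (le_Im_normc (x +i* y - z0)).
  case/orP: xy => H; apply: (lt_le_trans (_ : 0 < r / 2)) => //; rewrite ?divr_gt0//.
    exact: le_trans H (le_Re_normc (x +i* y - z0)).
  exact: le_trans H (le_Im_normc (x +i* y - z0)).
have r2 : 0 <= 2 / r by rewrite divr_ge0// ltW.
have far u u0 : (u <= u0 - r / 2) || (u0 + r / 2 <= u) -> r / 2 <= `|u - u0|.
  by clear; case/orP => H; rewrite ler_normr; apply/orP; [right|left]; lra.
have cr : y0 - r <= c <= y0 + r by clear -r0 c1 c2; apply/andP; split; lra.
have dr : y0 - r <= d <= y0 + r by clear -r0 d1 d2; apply/andP; split; lra.
have ar : x0 - r <= a <= x0 + r by clear -r0 a1 a2; apply/andP; split; lra.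
have br : x0 - r <= b <= x0 + r by clear -r0 b1 b2; apply/andP; split; lra.
have bl : x0 - r <= b by clear -r0 b1; lra. have dl : y0 - r <= d by clear -r0 d1; lra.
have S1 : normc (cintegral a b (fun x => h (x +i* c))) <= 2 * (2 / r * T).
  apply: cintegral_mul_bound => //.
  - by apply: integrable_normc_hseg => x xab; apply: hg => //; exact: sub xab.
  - by move=> x _; apply: kb; apply/orP; right; apply: far; rewrite c2'.
  - exact: hT.
have S2 : normc (cintegral a b (fun x => h (x +i* d))) <= 2 * (2 / r * T).
  apply: cintegral_mul_bound => //.
  - by apply: integrable_normc_hseg => x xab; apply: hg => //; exact: sub xab.
  - by move=> x _; apply: kb; apply/orP; right; apply: far; rewrite d1 orbT.
  - exact: hT.
have S3 : normc (cintegral c d (fun y => h (b +i* y))) <= 2 * (2 / r * T).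
  apply: cintegral_mul_bound => //.
  - by apply: integrable_normc_vseg => x xab; apply: hg => //; exact: sub xab.
  - by move=> x _; apply: kb; apply/orP; left; apply: far; rewrite b1 orbT.
  - exact: vT.
have S4 : normc (cintegral c d (fun y => h (a +i* y))) <= 2 * (2 / r * T).
  apply: cintegral_mul_bound => //.
  - by apply: integrable_normc_vseg => x xab; apply: hg => //; exact: sub xab.
  - by move=> x _; apply: kb; apply/orP; left; apply: far; rewrite a2'.
  - exact: vT.
have tri (z w : R[i]) : normc (z - w) <= normc z + normc w.
  by apply: (le_trans (le_normcD _ _)); rewrite normcN.
rewrite /rect_integral; apply: (le_trans (le_normcD _ _)); rewrite normcM normc_i mul1r.
have -> : 16 * T / r = 2 * (2 / r * T) + 2 * (2 / r * T) + (2 * (2 / r * T) + 2 * (2 / r * T)).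
  by field; rewrite gt_eqF.
by apply: lerD; apply: (le_trans (tri _ _)); [exact: (lerD S1 S2) | exact: (lerD S3 S4)].
Qed.

End AreaMean.

(** * Mean value inequalities along segments *)

Section PartialDerivatives.
Context {R : realType}.
Implicit Types (f : R[i]^o -> R[i]^o) (x y a b : R).

Lemma is_derive_eps (u : R -> R) x l :
  (forall e, 0 < e -> exists2 d, 0 < d & forall h, `|h| < d -> h != 0 ->
     `|(u (x + h) - u x) / h - l| <= e) -> is_derive x 1 u l.
Proof.
move=> H.
have c : (fun h => h^-1 *: ((u \o shift x) (h *: 1) - u x)) @ 0^' --> l.
  apply/cvgrPdist_le => e /H[d d0 dP].
  exists d => // h /=; rewrite sub0r normrN => hd h0.
  by rewrite distrC [_ *: 1]mulr1 [h + x]addrC [_ *: _]mulrC; exact: dP.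
by apply: DeriveDef; [apply/cvg_ex; exists l | exact: cvg_lim].
Qed.

Lemma is_derive_hseg f x y : derivable f (x +i* y) 1 ->
  is_derive x 1 (fun x => Re (f (x +i* y))) (Re (derive1 f (x +i* y))) /\
  is_derive x 1 (fun x => Im (f (x +i* y))) (Im (derive1 f (x +i* y))).
Proof.
move=> /derivable_tends df.
have H e : 0 < e -> exists2 d, 0 < d & forall h, `|h| < d -> h != 0 ->
    normc ((f ((x + h) +i* y) - f (x +i* y)) / h%:C - derive1 f (x +i* y)) <= e.
  move=> /df[d d0 dP]; exists d => // h hd h0.
  have E : (x + h) +i* y - (x +i* y) = h%:C.
    by apply/eqP; rewrite eq_complex /= addrAC !subrr add0r !eqxx.
  have := dP ((x + h) +i* y); rewrite E normc_real => /(_ hd); apply.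
  by rewrite -subr_eq0 E -normc_gt0 normc_real normr_gt0.
have Rdiv (z : R[i]) h : Re (z / h%:C) = Re z / h /\ Im (z / h%:C) = Im z / h.
  rewrite -fmorphV; case: z => p q /=.
  by split; ring.
split; apply: is_derive_eps => e /H[d d0 dP]; exists d => // h hd h0.
  rewrite -raddfB -(Rdiv _ _).1 -raddfB.
  exact: le_trans (le_Re_normc _) (dP h hd h0).
rewrite -raddfB -(Rdiv _ _).2 -raddfB.
exact: le_trans (le_Im_normc _) (dP h hd h0).
Qed.

(** The derivative along the imaginary axis is ['i] times the complex derivative. *)
Lemma is_derive_vseg f x y : derivable f (x +i* y) 1 ->
  is_derive y 1 (fun y => Re (f (x +i* y))) (- Im (derive1 f (x +i* y))) /\
  is_derive y 1 (fun y => Im (f (x +i* y))) (Re (derive1 f (x +i* y))).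
Proof.
move=> /derivable_tends df.
have H e : 0 < e -> exists2 d, 0 < d & forall h, `|h| < d -> h != 0 ->
    normc ((f (x +i* (y + h)) - f (x +i* y)) / ('i * h%:C) - derive1 f (x +i* y)) <= e.
  move=> /df[d d0 dP]; exists d => // h hd h0.
  have E : x +i* (y + h) - (x +i* y) = 'i * h%:C.
    apply/eqP; rewrite eq_complex /=.
    by apply/andP; split; apply/eqP; ring.
  have En : normc ('i * h%:C) = `|h|.
    by rewrite normcM normc_i mul1r normc_real.
  have := dP (x +i* (y + h)); rewrite E En => /(_ hd); apply.
  by rewrite -subr_eq0 E -normc_gt0 En normr_gt0.
have Rdiv (z : R[i]) h : Re z / h = - Im (z / ('i * h%:C)) /\ Im z / h = Re (z / ('i * h%:C)).
  have -> : z / ('i * h%:C) = - 'i * z / h%:C.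
    have [->|h0] := eqVneq h 0; first by rewrite !(mulr0, invr0).
    have hC : h%:C != 0 by rewrite -normc_gt0 normc_real normr_gt0.
    have iC : 'i != 0 :> R[i] by rewrite eq_complex /= negb_and oner_eq0 orbT.
    rewrite invfM mulrA; congr (_ / _); apply: (mulIf iC); rewrite divfK//.
    by rewrite mulrAC mulNr -expr2 sqr_i opprK mul1r.
  rewrite -fmorphV; case: z => p q /=.
  by split; ring.
split; apply: is_derive_eps => e /H[d d0 dP]; exists d => // h hd h0.
  rewrite -raddfB; have -> := (Rdiv (f (x +i* (y + h)) - f (x +i* y)) h).1.
  rewrite -opprD normrN -raddfB.
  exact: le_trans (le_Im_normc _) (dP h hd h0).
rewrite -raddfB; have -> := (Rdiv (f (x +i* (y + h)) - f (x +i* y)) h).2.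
rewrite -raddfB.
exact: le_trans (le_Re_normc _) (dP h hd h0).
Qed.

Lemma mvt_bound (u du : R -> R) a b M : a <= b ->
  (forall x, a <= x <= b -> is_derive x 1 u (du x)) ->
  (forall x, a <= x <= b -> `|du x| <= M) -> `|u b - u a| <= M * (b - a).
Proof.
move=> ab hu dM.
have cu : {within `[a, b], continuous u}.
  apply: derivable_within_continuous => x; rewrite in_itv/= => /hu.
  by case.
have hu' x : x \in `]a, b[ -> is_derive x 1 u (du x).
  by rewrite in_itv/= => /andP[xa xb]; apply: hu; rewrite !ltW.
have [c] := MVT_segment ab hu' cu.
rewrite in_itv/= => cab ->; rewrite normrM [`|b - a|]ger0_norm ?subr_ge0//.
by apply: ler_wpM2r; [rewrite subr_ge0 | exact: dM].
Qed.

Lemma hseg_mvt_bound f a b y M : a <= b ->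
  (forall x, a <= x <= b -> derivable f (x +i* y) 1) ->
  (forall x, a <= x <= b -> normc (derive1 f (x +i* y)) <= M) ->
  normc (f (b +i* y) - f (a +i* y)) <= 2 * M * (b - a).
Proof.
move=> ab df fM; apply: (le_trans (normc_le _)).
have H1 : `|Re (f (b +i* y)) - Re (f (a +i* y))| <= M * (b - a).
  apply: (mvt_bound (u := fun x => Re (f (x +i* y)))
    (du := fun x => Re (derive1 f (x +i* y)))) => // x xab.
    exact: (is_derive_hseg (df x xab)).1.
  exact: le_trans (le_Re_normc _) (fM x xab).
have H2 : `|Im (f (b +i* y)) - Im (f (a +i* y))| <= M * (b - a).
  apply: (mvt_bound (u := fun x => Im (f (x +i* y)))
    (du := fun x => Im (derive1 f (x +i* y)))) => // x xab.
    exact: (is_derive_hseg (df x xab)).2.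
  exact: le_trans (le_Im_normc _) (fM x xab).
rewrite !raddfB; move: H1 H2; move: `|_| `|_| => *; lra.
Qed.

Lemma vseg_mvt_bound f x a b M : a <= b ->
  (forall y, a <= y <= b -> derivable f (x +i* y) 1) ->
  (forall y, a <= y <= b -> normc (derive1 f (x +i* y)) <= M) ->
  normc (f (x +i* b) - f (x +i* a)) <= 2 * M * (b - a).
Proof.
move=> ab df fM; apply: (le_trans (normc_le _)).
have H1 : `|Re (f (x +i* b)) - Re (f (x +i* a))| <= M * (b - a).
  apply: (mvt_bound (u := fun y => Re (f (x +i* y)))
    (du := fun y => - Im (derive1 f (x +i* y)))) => // y yab.
    exact: (is_derive_vseg (df y yab)).1.
  by rewrite normrN; exact: le_trans (le_Im_normc _) (fM y yab).
have H2 : `|Im (f (x +i* b)) - Im (f (x +i* a))| <= M * (b - a).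
  apply: (mvt_bound (u := fun y => Im (f (x +i* y)))
    (du := fun y => Re (derive1 f (x +i* y)))) => // y yab.
    exact: (is_derive_vseg (df y yab)).2.
  exact: le_trans (le_Re_normc _) (fM y yab).
rewrite !raddfB; move: H1 H2; move: `|_| `|_| => *; lra.
Qed.

Lemma holomorphic_rect_bounded a b c d f : a <= b -> c <= d ->
  holomorphic_on_rect a b c d f ->
  exists M, forall x y, a <= x <= b -> c <= y <= d -> normc (f (x +i* y)) <= M.
Proof.
move=> ab cd hf.
pose A : set (R * R) := `[a, b] `*` `[c, d].
have cA : compact A by apply: compact_setX; exact: segment_compact.
have A0 : A !=set0 by exists (a, c); split; rewrite /= in_itv/= lexx.
have cf : {within A, continuous (fun w : R * R => normc (f (w.1 +i* w.2)))}.
  apply: continuous_in_subspaceT => w; rewrite inE => -[/=]; rewrite !in_itv/= => w1 w2.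
  apply/cvgrPdist_le => e e0.
  have [r r0 rP] := derivable_eps_continuous (hf _ _ w1 w2) e0.
  have r20 : 0 < r / 2 by rewrite divr_gt0.
  exists (ball w.1 (r / 2), ball w.2 (r / 2)) => /=.
    by split; apply: nbhsx_ballx.
  move=> [v1 v2] [/= b1 b2]; rewrite distrC; apply: (le_trans (ler_dist_normc _ _)).
  apply: rP; apply: (le_lt_trans (normc_le _)); move: b1 b2.
  by rewrite /ball /= !(distrC _ v1) !(distrC _ v2); lra.
have [w wA wmax] := compact_EVT_max A0 cA cf.
exists (normc (f (w.1 +i* w.2))) => x y xab ycd.
by apply: (wmax (x, y)); rewrite inE; split; rewrite /= in_itv.
Qed.

End PartialDerivatives.

(** * The area mean of a derivative *)

Section DerivativeAreaMean.
Context {R : realType}.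
Notation plane := (measurableTypeR R * measurableTypeR R)%type.
Notation mu := (@lebesgue_measure R).
Implicit Types (x y r T : R) (f : R[i]^o -> R[i]^o).

Lemma near_unit_disc x0 y0 r x y : 0 < r -> normc (x0 +i* y0) + 8 * r <= 1 ->
  `|x - x0| <= 3 * r -> `|y - y0| <= 3 * r -> unit_disc (x +i* y).
Proof.
move=> r0 z0r xr yr; apply/unit_discE; rewrite -[x +i* y](subrK (x0 +i* y0)).
apply: (le_lt_trans (le_normcD _ _)).
have := normc_le (x +i* y - x0 +i* y0); rewrite /= => H.
by move: z0r H; move: (normc _) (normc _) => u v; lra.
Qed.

Lemma square_measure x0 y0 r : 0 <= r ->
  (mu \x mu)%E (square x0 y0 r) = (4 * r ^+ 2)%:E.
Proof.
move=> r0; rewrite product_measure1E//=.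
have side u : mu `[u - r, u + r] = (2 * r)%:E.
  rewrite lebesgue_measure_itv/= lte_fin; case: ltgtP.
  - by move=> _; rewrite -EFinB; congr EFin; ring.
  - by move=> H; exfalso; lra.
  - by move=> H; congr EFin; lra.
by rewrite !side -EFinM; congr EFin; ring.
Qed.

(** [area_mean] holds for the difference quotients of [f]. They converge to the derivative and
are bounded near the centre, since Cauchy's estimate bounds the derivative there; so the
area integrals converge by domination. *)
Lemma area_mean_derive1 x0 y0 r f T : 0 < r -> normc (x0 +i* y0) + 8 * r <= 1 ->
  holomorphic_on_disc f ->
  (\int[mu \x mu]_(w in square x0 y0 r) (normc (derive1 f (w.1 +i* w.2)))%:E <
    (T * (r / 2))%:E)%E ->
  normc (derive1 f (x0 +i* y0)) <= 16 * T / r.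
Proof.
move=> r0 z0r hf intT.
have inD x y : `|x - x0| <= 3 * r -> `|y - y0| <= 3 * r -> unit_disc (x +i* y).
  exact: near_unit_disc.
have mid (u u0 s : R) : u0 - s <= u <= u0 + s -> `|u - u0| <= s.
  by clear; move=> /andP[? ?]; rewrite ler_norml; apply/andP; split; lra.
have [M fM] : exists M, forall x y, `|x - x0| <= 3 * r -> `|y - y0| <= 3 * r ->
    normc (f (x +i* y)) <= M.
  have [||x y xr yr|M fM] := @holomorphic_rect_bounded _ (x0 - 3 * r) (x0 + 3 * r)
      (y0 - 3 * r) (y0 + 3 * r) f.
  - by clear -r0; lra.
  - by clear -r0; lra.
  - by apply: hf; apply: inD; exact: mid.
  - by exists M => x y; rewrite !ler_distl; exact: fM.
pose B := 32 * M / r.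
have tri (u v w s t : R) : `|u - v| <= s -> `|v - w| <= t -> `|u - w| <= s + t.
  by clear; rewrite !ler_norml => /andP[? ?] /andP[? ?]; apply/andP; split; lra.
have dB x y : `|x - x0| <= 2 * r -> `|y - y0| <= 2 * r -> normc (derive1 f (x +i* y)) <= B.
  move=> xr yr; apply: derive1_le_sup => // x' y' xr' yr'.
  have e3 : 3 * r = r + 2 * r by ring.
  have xx : `|x' - x0| <= 3 * r by rewrite e3; exact: tri xr' xr.
  have yy : `|y' - y0| <= 3 * r by rewrite e3; exact: tri yr' yr.
  by split; [apply: hf; exact: inD | exact: fM].
(* From rank [N] on, the shifted points stay within the region where [f] is controlled. *)
have [N _ hN] : \forall n \near \oo, n.+1%:R^-1 < r.
  exact: near_infty_natSinv_lt (PosNum r0).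
pose h n : R := (n + N).+1%:R^-1.
have h0 n : 0 < h n by rewrite invr_gt0.
have hr n : h n < r by apply: hN; rewrite /= leq_addl.
pose g n : R[i]^o -> R[i]^o := fun z => (h n)^-1%:C * (f (z + (h n)%:C) - f z).
have shiftE n x y : x +i* y + (h n)%:C = (x + h n) +i* y.
  by apply/eqP; rewrite eq_complex /= addr0 !eqxx.
have xh n x : `|x - x0| <= r -> `|x + h n - x0| <= 2 * r.
  have := h0 n; have := hr n; clear; rewrite !ler_norml => ? ? /andP[? ?].
  by apply/andP; split; lra.
have r2 u : `|u| <= r -> `|u| <= 2 * r by clear -r0; move=> ?; lra.
have r3 u : `|u| <= 2 * r -> `|u| <= 3 * r by clear -r0; move=> ?; lra.
have gq n x y : `|x - x0| <= r -> `|y - y0| <= r ->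
    real_quotient f (n + N) (x +i* y) = g n (x +i* y).
  move=> xr yr; rewrite /real_quotient /g -/(h n) shiftE !cutoffE.
  - by rewrite /h invrK.
  - by apply: inD; [apply/r3/r2|apply/r3/r2].
  - by apply: inD; [apply/r3/xh|apply/r3/r2].
have dg n x y : `|x - x0| <= r -> `|y - y0| <= r -> derivable (g n) (x +i* y) 1.
  move=> xr yr.
  have d1 : derivable f (x +i* y) 1 by apply: hf; apply: inD; apply/r3/r2.
  have d2 : derivable f (x +i* y + (h n)%:C) 1.
    by rewrite shiftE; apply: hf; apply: inD; [apply/r3/xh|apply/r3/r2].
  have d3 : derivable (fun z : R[i]^o => f (z + (h n)%:C)) (x +i* y) 1.
    have [_ H] := derivable1_diffP (fun z : R[i]^o => f (z + (h n)%:C)) (x +i* y).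
    apply: H; apply: (@differentiable_comp _ _ _ _ (fun z : R[i]^o => z + (h n)%:C : R[i]^o) f).
      apply: differentiableD; [exact: ex_diff|exact: differentiable_cst].
    by apply/derivable1_diffP.
  exact: (derivableM (@derivable_cst _ _ _ ((h n)^-1%:C : R[i]^o) _ _) (derivableB d3 d1)).
have gB n x y : `|x - x0| <= r -> `|y - y0| <= r -> normc (g n (x +i* y)) <= 2 * B.
  move=> xr yr; rewrite /g normcM shiftE normc_real gtr0_norm ?invr_gt0//.
  rewrite mulrC ler_pdivrMr//.
  have xx : x <= x + h n by rewrite lerDl ltW.
  have seg t : x <= t <= x + h n -> `|t - x0| <= 2 * r.
    have := hr n; clear -xr; move: xr; rewrite !ler_norml => /andP[? ?] ? /andP[? ?].
    by apply/andP; split; lra.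
  have := @hseg_mvt_bound _ f x (x + h n) y B xx.
  rewrite addrAC subrr add0r; apply => t tx.
    by apply: hf; apply: inD; [apply/r3/seg|apply/r3/r2].
  by apply: dB; [exact: seg|exact: r2].
have sqE w : square x0 y0 r w -> `|w.1 - x0| <= r /\ `|w.2 - y0| <= r.
  by case; rewrite /= !in_itv/= => w1 w2; split; exact: mid.
have mS := measurable_square x0 y0 r.
have subD : square x0 y0 r `<=` plane_disc.
  by move=> w /sqE[w1 w2]; apply: inD; apply/r3/r2.
have mg n : measurable_fun (square x0 y0 r) (fun w => normc (g n (cplx w))).
  have := measurable_funTS (D := square x0 y0 r) (measurable_real_quotient (n + N) hf).
  by apply: eq_measurable_fun => w; rewrite inE => /sqE[w1 w2]; rewrite gq.
have mdf : measurable_fun (square x0 y0 r) (fun w => normc (derive1 f (w.1 +i* w.2))).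
  exact: measurable_funS measurable_plane_disc subD (measurable_normc_derive1 hf).
have iB : (mu \x mu)%E.-integrable (square x0 y0 r) (EFin \o (fun=> 2 * B)).
  apply/integrableP; split; first exact/measurable_EFinP.
  rewrite (_ : (fun w : plane => _) = cst `|2 * B|%:E)//.
  by rewrite integral_cst//= square_measure ?ltW// -EFinM ltry.
have [] := @dominated_convergence _ _ _ (mu \x mu)%E (square x0 y0 r) mS
  (fun n w => (normc (g n (cplx w)))%:E) (fun w => (normc (derive1 f (w.1 +i* w.2)))%:E)
  (EFin \o (fun=> 2 * B)).
- by move=> n; exact/measurable_EFinP.
- exact/measurable_EFinP.
- apply: aeW => w /sqE[w1 w2]; apply: cvg_EFin; first by near=> n.
  have Dw : unit_disc (cplx w) by apply: inD; apply/r3/r2.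
  have := real_quotient_cvg hf Dw.
  rewrite -(cvg_shiftn N); apply: cvg_trans; apply: near_eq_cvg; near=> n.
  by rewrite /= gq.
- exact: iB.
- by apply: aeW => w n /sqE[w1 w2]; rewrite /= lee_fin ger0_norm ?normc_ge0// gB.
move=> _ _ cv.
have z0D : unit_disc (x0 +i* y0) by apply: inD; rewrite subrr normr0 mulr_ge0// ltW.
have := real_quotient_cvg hf z0D.
rewrite -(cvg_shiftn N) => /cvgr_to_le; apply.
have [n0 _ n0P] := cv _ (open_nbhs_nbhs (conj (@open_ereal_lt_ereal _ (T * (r / 2))%:E)
  (intT : [set y | (y < (T * (r / 2))%:E)%E] _))).
 exists n0 => // n /n0P /= int_n.
have xy0 : `|x0 - x0| <= r /\ `|y0 - y0| <= r by rewrite !subrr normr0 ltW.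
rewrite gq ?xy0.1 ?xy0.2//; apply: area_mean => //.
move=> x y xr yr; apply: dg; exact: mid.
Unshelve. all: by end_near. Qed.

End DerivativeAreaMean.

(** * Besov functions are Bloch functions *)

Section BesovSpace.
Context {R : realType}.
Notation plane := (measurableTypeR R * measurableTypeR R)%type.
Implicit Types (x y r p : R) (f g h : R[i]^o -> R[i]^o).

Definition besov_density p f (w : plane) : R :=
  normc (derive1 f (w.1 +i* w.2)) `^ p * (1 - normc (w.1 +i* w.2) ^+ 2) `^ (p - 2).

Lemma besov_integralE p f : besov_integral p f =
  (\int[area_measure]_(w in plane_disc) (besov_density p f w)%:E)%E.
Proof. by []. Qed.

Lemma besov_density_ge0 p f w : 0 <= besov_density p f w.
Proof. by rewrite mulr_ge0// powR_ge0. Qed.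

Lemma measurable_besov_density p f : holomorphic_on_disc f ->
  measurable_fun plane_disc (EFin \o besov_density p f).
Proof.
move=> hf; apply/measurable_EFinP; apply: measurable_funM.
  exact: (measurableT_comp (measurable_powR p) (measurable_normc_derive1 hf)).
apply: (measurableT_comp (measurable_powR (p - 2))).
apply: measurable_funB => //; apply: measurable_funX.
apply: measurable_funTS; apply: measurable_normc; [exact: measurable_fst|exact: measurable_snd].
Qed.

Lemma powR_abs_le (s q : R) : 1 <= s -> s <= 20 -> (20 `^ `|q|)^-1 <= s `^ q.
Proof.
move=> s1 s20; apply: (@le_trans _ _ (s `^ (- `|q|))).
  rewrite powRN lef_pV2 ?posrE ?powR_gt0//; last lra.
  by apply: ge0_ler_powR; rewrite ?nnegrE ?normr_ge0//; lra.
by apply: ler_powR => //; rewrite lerNl -normrN ler_norm.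
Qed.

(** A form of Young's inequality that replaces Hoelder's when the mean of [t] has to be
bounded by that of [t `^ p]: the parameter [a] is optimized at the end. *)
Lemma le_add_powR (a t p : R) : 1 < p -> 0 < a -> t <= a + a `^ (1 - p) * t `^ p.
Proof.
move=> p1 a0; have [ta|at_] := lerP t a.
  by apply: (le_trans ta); rewrite lerDl mulr_ge0// powR_ge0.
have t0 : 0 < t by exact: lt_trans at_.
apply: (@le_trans _ _ (a `^ (1 - p) * t `^ p)); last by rewrite lerDr ltW.
rewrite -[1 - p]opprB powRN ler_pdivlMl ?powR_gt0//.
have tp : t `^ p = t `^ (p - 1) * t.
  rewrite -[X in _ * X](powRr1 (ltW t0)) -powRD ?subrK//.
  by apply/implyP => _; rewrite gt_eqF.
rewrite tp; apply: ler_wpM2r; first exact: ltW.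
by apply: ge0_ler_powR; rewrite ?nnegrE ?subr_ge0 ltW.
Qed.

Lemma square_dist x0 y0 r w : square x0 y0 r w ->
  `|w.1 - x0| <= r /\ `|w.2 - y0| <= r.
Proof.
have mid (u u0 : R) : u0 - r <= u <= u0 + r -> `|u - u0| <= r.
  by clear; move=> /andP[? ?]; rewrite ler_norml; apply/andP; split; lra.
by case; rewrite /= !in_itv/= => w1 w2; split; exact: mid.
Qed.

(** [1 - |w| ^+ 2] lies between [r] and [20 * r] on the square, so its power [p - 2] is
comparable to that of [r], whatever the sign of [p - 2]. [le_add_powR] is used with
[a = delta / r]. *)
Lemma derive1_le_besov_density p (delta r : R) x0 y0 f w : 1 < p -> 0 < delta ->
  0 < r -> normc (x0 +i* y0) + 8 * r = 1 -> square x0 y0 r w ->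
  normc (derive1 f (w.1 +i* w.2)) <= delta / r +
    delta `^ (1 - p) * r * 20 `^ `|p - 2| * besov_density p f w.
Proof.
move=> p1 d0 r0 z0r wS.
have weight (u v : R) : 0 <= u -> 0 <= v -> `|u - v| <= 2 * r -> v + 8 * r = 1 ->
    r <= 1 - u ^+ 2 /\ 1 - u ^+ 2 <= 20 * r.
  clear -r0; rewrite ler_norml => u0 v0 /andP[? ?] ?.
  have u1 : u * u <= u * 1 by apply: ler_wpM2l => //; lra.
  have := sqr_ge0 (u - 1); rewrite sqrrB1 !expr2 -mulr_natl.
  by split; lra.
have [s [s1 s20 sE]] : exists s, [/\ 1 <= s, s <= 20 &
    1 - normc (w.1 +i* w.2) ^+ 2 = r * s].
  have dist : `|normc (w.1 +i* w.2) - normc (x0 +i* y0)| <= 2 * r.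
    apply: (le_trans (ler_dist_normc _ _)); apply: (le_trans (normc_le _)) => /=.
    have [w1 w2] := square_dist wS.
    by rewrite mulr_natl mulr2n; exact: lerD.
  exists ((1 - normc (w.1 +i* w.2) ^+ 2) / r); split; last by rewrite mulrCA divff ?mulr1// gt_eqF.
    by rewrite ler_pdivlMr// mul1r (weight _ _ (normc_ge0 _) (normc_ge0 _) dist z0r).1.
  by rewrite ler_pdivrMr// (weight _ _ (normc_ge0 _) (normc_ge0 _) dist z0r).2.
set t := normc (derive1 f _).
have rd : 0 < delta / r by rewrite divr_gt0.
apply: (le_trans (le_add_powR t p1 rd)); rewrite lerD2l.
have s0 : 0 <= s by lra.
rewrite /besov_density -/t sE (powRM (p - 2) (ltW r0) s0).
have S := powR_abs_le (p - 2) s1 s20.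
have -> : (delta / r) `^ (1 - p) = delta `^ (1 - p) * (r * r `^ (p - 2)).
  rewrite powRM ?invr_ge0 ?ltW//; congr (_ * _).
  rewrite -{2}(powRr1 (ltW r0)) -powRD; last by apply/implyP => _; rewrite gt_eqF.
  have -> : r^-1 = r `^ (-1) by rewrite powR_inv1// ltW.
  by rewrite -powRrM; congr (_ `^ _); ring.
set A := delta `^ _; set B := r `^ _; set C := t `^ _; set D := 20 `^ _.
have D0 : 0 < D by exact: powR_gt0.
have D1 : 1 <= D * s `^ (p - 2).
  apply: (le_trans (_ : 1 <= D * D^-1)); first by rewrite divff// gt_eqF.
  exact: (ler_wpM2l (ltW D0) S).
rewrite (_ : A * r * D * _ = A * (r * B) * C * (D * s `^ (p - 2))); last by ring.
by apply: ler_peMr => //; rewrite !mulr_ge0 ?powR_ge0// ltW.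
Qed.

(** The estimate of [derive1_le_besov_density] integrates over the square of half-side
[r = (1 - |z|) / 8] to at most [5 * delta * r], and [area_mean_derive1] turns this into a
bound of the derivative at the centre by a multiple of [delta / r]. Since [delta] is
arbitrary, the lemma gives both the finiteness of the Bloch seminorm on the Besov space and
its smallness for small Besov integrals. *)
Lemma besov_bloch p : 1 < p -> exists2 m : R, 0 < m & forall f (delta : R),
  holomorphic_on_disc f -> 0 < delta ->
  (besov_integral p f <= (m * delta `^ p)%:E)%E ->
  forall z, unit_disc z -> (1 - normc z) * normc (derive1 f z) <= 1536 * delta.
Proof.
move=> p1; pose D : R := 20 `^ `|p - 2|.
have D0 : 0 < D by exact: powR_gt0.
exists D^-1; first by rewrite invr_gt0.
move=> f delta hf d0 If [x0 y0] /unit_discE z1.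
pose r := (1 - normc (x0 +i* y0)) / 8.
have r0 : 0 < r by rewrite divr_gt0// subr_gt0.
have z0r : normc (x0 +i* y0) + 8 * r = 1 by rewrite /r; field.
have mS := measurable_square x0 y0 r.
have subD : square x0 y0 r `<=` plane_disc.
  have r3 (u : R) : `|u| <= r -> `|u| <= 3 * r by clear -r0; move=> ?; lra.
  move=> w /square_dist[w1 w2].
  by apply: (@near_unit_disc _ x0 y0 r _ _ r0 _ (r3 _ w1) (r3 _ w2)); rewrite z0r.
pose k := delta `^ (1 - p) * r * D.
have k0 : 0 <= k by exact: (mulr_ge0 (mulr_ge0 (powR_ge0 _ _) (ltW r0)) (ltW D0)).
have md : measurable_fun (square x0 y0 r) (EFin \o besov_density p f).
  exact: measurable_funS measurable_plane_disc subD (measurable_besov_density p hf).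
have rd : 0 <= delta / r by rewrite divr_ge0// ltW.
have int_le : (\int[area_measure]_(w in square x0 y0 r) (normc (derive1 f (w.1 +i* w.2)))%:E
    <= (5 * delta * r)%:E)%E.
  apply: (@le_trans _ _ (\int[area_measure]_(w in square x0 y0 r)
     (cst (delta / r)%:E w + k%:E * (EFin \o besov_density p f) w))%E).
    apply: ge0_le_integral => //.
    - by move=> w _; rewrite lee_fin normc_ge0.
    - apply/measurable_EFinP.
      exact: measurable_funS measurable_plane_disc subD (measurable_normc_derive1 hf).
    - apply: emeasurable_funD; [exact: measurable_cst | exact: (measurable_funeM k%:E md)].
    - move=> w wS; rewrite /= -EFinM -EFinD lee_fin.
      exact: (derive1_le_besov_density f p1 d0 r0 z0r wS).
  rewrite ge0_integralD//; first last.
  - exact: (measurable_funeM k%:E md).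
  - by move=> w _; rewrite mule_ge0// lee_fin besov_density_ge0.
  rewrite integral_cst//= (square_measure _ _ (ltW r0)).
  rewrite ge0_integralZl_EFin//; last by move=> w _; rewrite lee_fin besov_density_ge0.
  have IS : (\int[area_measure]_(w in square x0 y0 r) (EFin \o besov_density p f) w <=
      (D^-1 * delta `^ p)%:E)%E.
    apply: le_trans If; rewrite besov_integralE; apply: ge0_subset_integral => //.
    - exact: measurable_plane_disc.
    - exact: measurable_besov_density.
    - by move=> w _; rewrite lee_fin besov_density_ge0.
  apply: (@le_trans _ _ (delta / r * (4 * r ^+ 2) + k * (D^-1 * delta `^ p))%:E).
    by rewrite EFinD !EFinM; apply: leeD => //; rewrite -EFinM; exact: lee_wpmul2l.
  rewrite lee_fin le_eqVlt; apply/orP; left; apply/eqP.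
  rewrite /k (_ : _ * D * (D^-1 * delta `^ p) =
                  (delta `^ (1 - p) * delta `^ p) * r); last first.
    by field; rewrite gt_eqF.
  rewrite -powRD ?subrK ?powRr1 ?ltW//; last by apply/implyP => _; rewrite gt_eqF.
  by field; rewrite gt_eqF.
have := @area_mean_derive1 _ x0 y0 r f (12 * delta) r0 _ hf.
rewrite z0r => /(_ (lexx _)) H.
have {}H : normc (derive1 f (x0 +i* y0)) <= 16 * (12 * delta) / r.
  apply: H; apply: (le_lt_trans int_le); rewrite lte_fin.
  by have := mulr_gt0 d0 r0; clear; move=> ?; nra.
have -> : 1 - normc (x0 +i* y0) = 8 * r by rewrite /r; field.
move: H; rewrite ler_pdivlMr// => H.
by move: H; move: (normc _) => u; clear; lra.
Qed.

End BesovSpace.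

(** * Holomorphic self-maps of the disc *)

Section SelfMaps.
Context {R : realType}.
Implicit Types (f g psi : R[i]^o -> R[i]^o) (z : R[i]^o).

Lemma derivable_comp f psi z : derivable psi z 1 -> derivable f (psi z) 1 ->
  derivable (f \o psi) z 1.
Proof.
move=> /derivable1_diffP dp /derivable1_diffP df; apply/derivable1_diffP.
exact: (@differentiable_comp _ _ _ _ psi f z dp df).
Qed.

Lemma derive1_chain f psi z : derivable psi z 1 -> derivable f (psi z) 1 ->
  derive1 (f \o psi) z = derive1 f (psi z) * derive1 psi z.
Proof.
move=> dp df; have /derivable1_diffP dfp := derivable_comp dp df.
rewrite (derive1E' dfp).
have /derivable1_diffP dp' := dp; have /derivable1_diffP df' := df.
rewrite (@diff_comp _ _ _ _ psi f z dp' df').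
pose F : R[i]^o -> R[i]^o := 'd f (psi z).
have E1 : F (derive1 psi z) = derive1 psi z * derive1 f (psi z).
  exact: (congr1 (fun G : R[i]^o -> R[i]^o => G (derive1 psi z)) (deriv1E df)).
have E2 : ('d psi z : R[i]^o -> R[i]^o) 1 = derive1 psi z.
  exact: (esym (derive1E' dp')).
transitivity (F (('d psi z : R[i]^o -> R[i]^o) 1)); first by [].
by rewrite E2 E1; exact: mulrC.
Qed.

Definition disc_self_map psi :=
  holomorphic_on_disc psi /\ forall z, unit_disc z -> unit_disc (psi z).

Lemma normc_sqr z : normc z ^+ 2 = Re z ^+ 2 + Im z ^+ 2.
Proof. by case: z => x y; rewrite sqr_sqrtr// addr_ge0 ?sqr_ge0. Qed.

Lemma normc_moebius_lt1 (a w : R[i]) : normc a < 1 -> normc w < 1 ->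
  normc (w - a) < normc (1 - a^*%C * w).
Proof.
move=> a1 w1; rewrite -(@ltr_pXn2r _ 2) ?nnegrE ?normc_ge0// -subr_gt0.
have -> : normc (1 - a^*%C * w) ^+ 2 - normc (w - a) ^+ 2 =
    (1 - normc a ^+ 2) * (1 - normc w ^+ 2).
  by rewrite !normc_sqr; case: a {a1} => p q; case: w {w1} => s t /=; ring.
by rewrite mulr_gt0// subr_gt0 expr_lt1// normc_ge0.
Qed.

Lemma normc_moebius_den (a : R[i]) : normc a < 1 ->
  normc (1 - a^*%C * a) = 1 - normc a ^+ 2.
Proof.
move=> a1; have -> : 1 - a^*%C * a = (1 - normc a ^+ 2)%:C.
  rewrite normc_sqr; case: a {a1} => p q; apply/eqP; rewrite eq_complex /=.
  by apply/andP; split; apply/eqP; ring.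
by rewrite normc_real ger0_norm// subr_ge0 expr_le1 ?normc_ge0// ltW.
Qed.

Lemma derive1_le_disc f z :
  (forall w, unit_disc w -> derivable f w 1 /\ normc (f w) <= 1) -> unit_disc z ->
  normc (derive1 f z) <= 128 / (1 - normc z).
Proof.
case: z => x0 y0 fD /unit_discE z1.
have r0 : 0 < (1 - normc (x0 +i* y0)) / 4 by rewrite divr_gt0// subr_gt0.
have -> : 128 / (1 - normc (x0 +i* y0)) = 32 * 1 / ((1 - normc (x0 +i* y0)) / 4).
  by field; rewrite gt_eqF// subr_gt0.
apply: derive1_le_sup => // x y xr yr; apply: fD; apply/unit_discE.
rewrite -[x +i* y](subrK (x0 +i* y0)).
apply: (le_lt_trans (le_normcD _ _)); have := normc_le (x +i* y - x0 +i* y0).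
by move: xr yr z1; rewrite /=; move: (normc _) (normc _) => u v; lra.
Qed.

(** Following [psi] by the Moebius transformation that sends [a = psi z] to 0 gives a function
bounded by 1 with derivative [derive1 psi z / (1 - |a| ^+ 2)] at [z]; Cauchy's estimate for
it leaves a factor 128, and [1 - |a| ^+ 2 <= 2 * (1 - |a|)] another 2. *)
Lemma schwarz_pick_weak psi z : disc_self_map psi -> unit_disc z ->
  (1 - normc z) * normc (derive1 psi z) <= 256 * (1 - normc (psi z)).
Proof.
move=> [hpsi mpsi] Dz.
have z1 : normc z < 1 by apply/unit_discE.
set a := psi z.
have a1 : normc a < 1 by apply/unit_discE; exact: mpsi.
pose den : R[i]^o -> R[i]^o := fun w => 1 - a^*%C * psi w.
pose num : R[i]^o -> R[i]^o := psi - cst a.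
pose B : R[i]^o -> R[i]^o := num * (fun w => (den w)^-1).
have den0 w : unit_disc w -> den w != 0.
  move=> Dw; rewrite -normc_gt0.
  apply: le_lt_trans (normc_moebius_lt1 a1 (_ : normc (psi w) < 1)); first exact: normc_ge0.
  by apply/unit_discE; exact: mpsi.
have dnum w : unit_disc w -> derivable num w 1.
  by move=> Dw; exact: (derivableB (hpsi w Dw) (@derivable_cst _ _ _ (a : R[i]^o) _ _)).
have dden w : unit_disc w -> derivable den w 1.
  move=> Dw; apply: (derivableB (@derivable_cst _ _ _ (1 : R[i]^o) _ _)).
  exact: (derivableM (@derivable_cst _ _ _ (a^*%C : R[i]^o) _ _) (hpsi w Dw)).
have dinv w : unit_disc w -> derivable (fun w => (den w)^-1 : R[i]^o) w 1.
  by move=> Dw; apply: derivableV; [exact: den0 | exact: dden].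
have dB w : unit_disc w -> derivable B w 1.
  by move=> Dw; exact: (derivableM (dnum w Dw) (dinv w Dw)).
have B1 w : unit_disc w -> normc (B w) <= 1.
  move=> Dw; rewrite -[B w]/((psi w - a) / den w) normc_div.
  rewrite ler_pdivrMr ?normc_gt0 ?den0// mul1r.
  by apply/ltW/normc_moebius_lt1 => //; apply/unit_discE; exact: mpsi.
have Bz : derive1 B z = (den z)^-1 * derive1 psi z.
  rewrite derive1E /B (deriveM (dnum z Dz) (dinv z Dz)).
  rewrite -[num z]/(a - a) subrr scale0r add0r.
  rewrite derive1E /num.
  by rewrite (deriveB (hpsi z Dz) (@derivable_cst _ _ _ (a : R[i]^o) _ _)) derive_cst subr0.
have denz : normc (den z) = 1 - normc a ^+ 2 by exact: normc_moebius_den.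
have := derive1_le_disc (fun w Dw => conj (dB w Dw) (B1 w Dw)) Dz.
rewrite Bz normcM normcV denz.
have := normc_ge0 a; have := normc_ge0 (derive1 psi z).
move: (normc (derive1 psi z)) (normc a) (normc z) a1 z1.
clear => t u v u1 v1 t0 u0.
have c0 : 0 < 1 - u ^+ 2 by rewrite subr_gt0 expr_lt1.
rewrite ler_pdivrMl// => H.
have w0 : 0 < 1 - v by rewrite subr_gt0.
apply: (le_trans (ler_wpM2l (ltW w0) H)).
rewrite mulrCA [(1 - v) * _]mulrC divfK ?gt_eqF//.
have := sqr_ge0 (u - 1); rewrite sqrrB1 -mulr_natl; lra.
Qed.

End SelfMaps.

(** * Non-hypercyclicity *)

Section BesovOperations.
Context {R : realType}.
Implicit Types (f g h psi phi : R[i]^o -> R[i]^o) (p K : R).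

Lemma powR_sum_le p K s t : 1 < p -> 0 <= K -> 0 <= s -> 0 <= t ->
  (K * (s + t)) `^ p <= (2 * K) `^ p * (s `^ p + t `^ p).
Proof.
move=> p1 K0; wlog st : s t / s <= t => [W s0 t0|s0 t0].
  have [st|/ltW ts] := lerP s t; first exact: W.
  by rewrite addrC [s `^ p + _]addrC; exact: W.
have p0 : 0 <= p by rewrite ltW// (lt_trans _ p1).
apply: (@le_trans _ _ ((2 * K * t) `^ p)).
  apply: ge0_ler_powR => //; rewrite ?nnegrE.
  - by rewrite mulr_ge0// addr_ge0.
  - by rewrite !mulr_ge0.
  - by rewrite [2 * K]mulrC -mulrA; apply: ler_wpM2l => //; rewrite mulr_natl mulr2n lerD2r.
rewrite powRM ?mulr_ge0//; apply: ler_wpM2l; first exact: powR_ge0.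
by rewrite lerDr powR_ge0.
Qed.

Lemma besov_density_le p K f g h w : 1 < p -> 0 <= K ->
  normc (derive1 h (w.1 +i* w.2)) <=
    K * (normc (derive1 f (w.1 +i* w.2)) + normc (derive1 g (w.1 +i* w.2))) ->
  besov_density p h w <=
    (2 * K) `^ p * besov_density p f w + (2 * K) `^ p * besov_density p g w.
Proof.
have key s t u v : 1 < p -> 0 <= K -> 0 <= s -> 0 <= t -> 0 <= u -> 0 <= v ->
    u <= K * (s + t) ->
    u `^ p * v <= (2 * K) `^ p * (s `^ p * v) + (2 * K) `^ p * (t `^ p * v).
  clear => p1 K0 s0 t0 u0 v0 ust.
  rewrite !mulrA -mulrDl -mulrDr; apply: ler_wpM2r => //.
  apply: le_trans (powR_sum_le p1 K0 s0 t0).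
  apply: ge0_ler_powR; rewrite ?nnegrE//; first by rewrite ltW// (lt_trans _ p1).
  by apply: mulr_ge0 => //; apply: addr_ge0.
move=> p1 K0 H.
exact: (key _ _ _ _ p1 K0 (normc_ge0 _) (normc_ge0 _) (normc_ge0 _) (powR_ge0 _ _) H).
Qed.

Lemma ge0_integral_lincomb_lty d (T : measurableType d)
    (nu : {measure set T -> \bar R}) (D : set T) (c : R) (F G : T -> \bar R) :
  measurable D -> 0 <= c -> (forall x, D x -> 0 <= F x)%E ->
  (forall x, D x -> 0 <= G x)%E -> measurable_fun D F -> measurable_fun D G ->
  (\int[nu]_(x in D) F x < +oo)%E -> (\int[nu]_(x in D) G x < +oo)%E ->
  (\int[nu]_(x in D) (c%:E * F x + c%:E * G x) < +oo)%E.
Proof.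
move=> mD c0 F0 G0 mF mG iF iG.
rewrite ge0_integralD//; first last.
- exact: measurable_funeM.
- by move=> x Dx; rewrite mule_ge0 ?G0.
- exact: measurable_funeM.
- by move=> x Dx; rewrite mule_ge0 ?F0.
rewrite !ge0_integralZl_EFin//.
by apply: lte_add_pinfty; apply: lte_mul_pinfty; rewrite ?lee_fin.
Qed.

Lemma besov_dominated p K f g h : 1 < p -> 0 <= K -> besov p f -> besov p g ->
  holomorphic_on_disc h ->
  (forall z, unit_disc z ->
    normc (derive1 h z) <= K * (normc (derive1 f z) + normc (derive1 g z))) ->
  besov p h.
Proof.
move=> p1 K0 [hf If] [hg Ig] hh hK; split; first exact: hh.
have mD := @measurable_plane_disc R.
have p0 : 0 <= p by rewrite ltW// (lt_trans _ p1).
have mf := measurable_besov_density p hf.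
have mg := measurable_besov_density p hg.
pose c := (2 * K) `^ p.
have toE (x y z : R) : x <= c * y + c * z -> (x%:E <= c%:E * y%:E + c%:E * z%:E)%E.
  by move=> H; rewrite -!EFinM -EFinD lee_fin.
rewrite besov_integralE; apply: (@le_lt_trans _ _
  (\int[area_measure]_(w in plane_disc) (c%:E * (EFin \o besov_density p f) w +
     c%:E * (EFin \o besov_density p g) w))%E).
  apply: ge0_le_integral; first exact: mD.
  - by move=> w _; rewrite lee_fin besov_density_ge0.
  - exact: measurable_besov_density.
  - by apply: emeasurable_funD;
      [exact: (measurable_funeM c%:E mf) | exact: (measurable_funeM c%:E mg)].
  - move=> w Dw; have H := besov_density_le p1 K0 (hK (w.1 +i* w.2) Dw).
    exact: (toE _ _ _ H).
have d0 u w : plane_disc w -> (0 <= (EFin \o besov_density p u) w)%E.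
  by move=> _; rewrite lee_fin besov_density_ge0.
exact: (ge0_integral_lincomb_lty mD (powR_ge0 _ _) (@d0 f) (@d0 g) mf mg If Ig).
Qed.

Lemma besovZ p f (c : R[i]) : 1 < p -> besov p f -> besov p (c *: f).
Proof.
move=> p1 bf; have [hf _] := bf.
apply: (besov_dominated p1 (normc_ge0 c) bf bf).
  by move=> z Dz; exact: (derivableZ (hf z Dz)).
move=> z Dz; rewrite derive1E (deriveZ _ (hf z Dz)) -derive1E.
rewrite -[X in normc X]/(c * derive1 f z) normcM; apply: ler_wpM2l; first exact: normc_ge0.
by rewrite lerDl normc_ge0.
Qed.

Lemma besovB p f g : 1 < p -> besov p f -> besov p g -> besov p (f - g).
Proof.
move=> p1 bf bg; have [hf _] := bf; have [hg _] := bg.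
apply: (besov_dominated p1 ler01 bf bg).
  by move=> z Dz; exact: (derivableB (hf z Dz) (hg z Dz)).
move=> z Dz; rewrite derive1E (deriveB (hf z Dz) (hg z Dz)) -!derive1E mul1r.
by apply: (le_trans (le_normcD _ _)); rewrite normcN.
Qed.

Lemma besov_cst p (c : R[i]) : 1 < p -> besov p (cst c).
Proof.
move=> p1; split; first by move=> z _; exact: derivable_cst.
rewrite besov_integralE integral0_eq// => w _.
rewrite /besov_density derive1_cst normc0 powR0 ?mul0r// gt_eqF// (lt_trans _ p1)//.
Qed.

(** Membership in the space matters: [besov_norm] reads an infinite integral as 0. *)
Lemma besov_norm_lt p f (e : R) : 1 < p -> 0 < e -> besov p f ->
  besov_norm p f < e `^ p^-1 -> (besov_integral p f <= e%:E)%E.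
Proof.
move=> p1 e0 [_ If]; have p0 : 0 < p by exact: lt_trans p1.
have I0 : (0 <= besov_integral p f)%E.
  by rewrite besov_integralE; apply: integral_ge0 => w _; rewrite lee_fin besov_density_ge0.
have Ifin : besov_integral p f \is a fin_num by rewrite ge0_fin_numE.
rewrite /besov_norm => H.
have F0 := fine_ge0 I0.
rewrite -(fineK Ifin) lee_fin leNgt; apply/negP => eF.
move: H; apply/negP; rewrite -leNgt; apply: ge0_ler_powR;
  rewrite ?nnegrE ?invr_ge0 ?(ltW p0) ?(ltW e0)//.
  by apply: addr_ge0 => //; exact: powR_ge0.
by apply: (le_trans (ltW eF)); rewrite lerDr powR_ge0.
Qed.

Lemma iter_self_map phi n : disc_self_map phi -> disc_self_map (iter n phi).
Proof.
move=> [hphi mphi]; elim: n => [|n [IHh IHm]].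
  by split=> [z _|z Dz]; [exact: derivable_id | exact: Dz].
split => z Dz; last by exact: mphi (IHm z Dz).
exact: (derivable_comp (IHh z Dz) (hphi _ (IHm z Dz))).
Qed.

Lemma iter_composition_operator phi f n :
  iter n (composition_operator phi) f = f \o iter n phi.
Proof.
elim: n => [//|n IH]; rewrite iterS IH /composition_operator; apply/funext => z /=.
by rewrite -iterSr iterS.
Qed.

(** The polygonal path from 0 to [x] to [x + iy] stays in the disc. *)
Lemma derive1_eq0_cst f z : holomorphic_on_disc f ->
  (forall w, unit_disc w -> derive1 f w = 0) -> unit_disc z -> f z = f 0.
Proof.
move=> hf f0; case: z => x y /unit_discE z1.
have inD u v : `|u| <= `|x| -> `|v| <= `|y| -> unit_disc (u +i* v).
  move=> ux vy; apply/unit_discE; apply: le_lt_trans z1.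
  rewrite -(@ler_pXn2r _ 2) ?nnegrE ?normc_ge0// !normc_sqr /=.
  by rewrite -(real_normK (num_real u)) -(real_normK (num_real v))
     -(real_normK (num_real x)) -(real_normK (num_real y)) lerD// ler_pXn2r// nnegrE.
have zero (u v : R[i]) (b : R) : normc (v - u) <= 2 * 0 * b -> v = u.
  by rewrite mulr0 mul0r => H; apply/eqP; rewrite -subr_eq0 -normc_eq0 eq_le H normc_ge0.
have hz (u v w : R) : u <= v -> (forall t, u <= t <= v -> unit_disc (t +i* w)) ->
    f (v +i* w) = f (u +i* w).
  move=> uv D; apply: (zero _ _ (v - u)).
  apply: (hseg_mvt_bound uv) => t /D Dt; first exact: hf.
  by rewrite f0 ?normc0.
have vz (u v w : R) : u <= v -> (forall t, u <= t <= v -> unit_disc (w +i* t)) ->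
    f (w +i* v) = f (w +i* u).
  move=> uv D; apply: (zero _ _ (v - u)).
  apply: (vseg_mvt_bound uv) => t /D Dt; first exact: hf.
  by rewrite f0 ?normc0.
have pos (u t : R) : 0 <= t <= u -> `|t| <= `|u|.
  by move=> /andP[t0 tu]; rewrite !ger0_norm// (le_trans t0).
have neg (u t : R) : u <= t <= 0 -> `|t| <= `|u|.
  by move=> /andP[tu t0]; rewrite !ler0_norm ?lerN2// (le_trans tu).
have H1 : f (x +i* 0) = f (0 +i* 0).
  have [x0|/ltW x0] := lerP 0 x.
    by apply: hz => // t /pos tx; apply: inD; rewrite ?normr0.
  by symmetry; apply: hz => // t /neg tx; apply: inD; rewrite ?normr0.
have H2 : f (x +i* y) = f (x +i* 0).
  have [y0|/ltW y0] := lerP 0 y.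
    by apply: vz => // t /pos ty; apply: inD.
  by symmetry; apply: vz => // t /neg ty; apply: inD.
by rewrite H2 H1.
Qed.

(** The argument explained at the beginning: [step] compares the Bloch seminorm of the vector with
half of itself up to an error, so a positive seminorm would be at most [3 / 4] of itself. *)
Lemma self_map_not_hypercyclic p phi : 1 < p -> disc_self_map phi ->
  ~ hypercyclic_on_besov p (composition_operator phi).
Proof.
move=> p1 sphi [f bf dense].
have p0 : 0 < p by exact: lt_trans p1.
have [m m0 bloch] := besov_bloch p1.
have [hf If] := bf.
pose N z := (1 - normc z) * normc (derive1 f z).
have [A0 NA0] : exists A, forall z, unit_disc z -> N z <= A.
  have I0 : (0 <= besov_integral p f)%E.
    by rewrite besov_integralE; apply: integral_ge0 => w _; rewrite lee_fin besov_density_ge0.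
  pose c := fine (besov_integral p f) / m + 1.
  have c0 : 0 < c by rewrite ltr_pwDr// divr_ge0 ?fine_ge0// ltW.
  exists (1536 * c `^ p^-1); apply: bloch; rewrite ?powR_gt0// -powRrM mulVf ?gt_eqF//.
  rewrite (powRr1 (ltW c0)) /c mulrDr mulr1 mulrCA divff ?gt_eqF// mulr1.
  by rewrite EFinD fineK ?ge0_fin_numE// leeDl// lee_fin ltW.
(* The orbit element close to [512 f] has seminorm at most [256 A], and [delta] makes the
   error of approximation [128 A]. *)
have step A : 0 < A -> (forall z, unit_disc z -> N z <= A) ->
    forall z, unit_disc z -> N z <= 3 / 4 * A.
  move=> A0' NA z Dz.
  pose delta := A / 12.
  have d0 : 0 < delta by rewrite divr_gt0// ltr0n.
  pose c := m * delta `^ p.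
  have c0 : 0 < c by rewrite mulr_gt0// powR_gt0.
  pose k : R[i] := 512%:R%:C.
  have tri (u v : R[i]) (w : R[i]^o) :
      512 * normc w <= normc (u * v - k *: w) + normc u * normc v.
    rewrite -normcM -(ger0_norm (ler0n R 512)) -normc_real -normcM.
    by rewrite -[X in normc X <= _](subrK (u * v)) normcB; exact: le_normcD.
  have arith (t s u v x y : R) : 0 <= y -> 0 <= t -> 512 * u <= v + t * s ->
      x * t <= A -> y * s <= 256 * x -> y * v <= 1536 * delta -> y * u <= 3 / 4 * A.
    rewrite /delta; clear => y0 t0 H1 H2 H3 H4.
    have K1 : y * (512 * u) <= y * v + y * (t * s).
      by rewrite -mulrDr; exact: ler_wpM2l.
    have K2 : y * (t * s) <= 256 * A.
      rewrite mulrCA; apply: (le_trans (ler_wpM2l t0 H3)).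
      by rewrite mulrCA [t * x]mulrC; exact: (ler_wpM2l (ler0n _ 256) H2).
    rewrite mulrCA in K1; lra.
  have bg := besovZ k p1 bf.
  have [_ [[n _ <-] bh] hg] := dense _ bg _ (powR_gt0 p^-1 c0).
  have bd := besovB p1 bh bg.
  have Id := besov_norm_lt p1 c0 bd hg.
  have [hd _] := bd.
  have := bloch _ delta hd d0 Id z Dz.
  have [hpsi mpsi] := iter_self_map n sphi.
  have dz := hf z Dz.
  rewrite iter_composition_operator.
  have dcomp := derivable_comp (hpsi z Dz) (hf _ (mpsi z Dz)).
  rewrite derive1E (deriveB dcomp (derivableZ (k := k) dz)) (deriveZ k dz) -!derive1E.
  rewrite (derive1_chain (hpsi z Dz) (hf _ (mpsi z Dz))).
  move=> bnd.
  have y0 : 0 <= 1 - normc z by move/unit_discE : Dz; rewrite subr_ge0 => /ltW.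
  exact: (arith _ _ _ _ _ _ y0 (normc_ge0 _) (tri _ _ _) (NA _ (mpsi z Dz))
    (schwarz_pick_weak (conj hpsi mpsi) Dz) bnd).
have N0 z : unit_disc z -> N z = 0.
  move=> Dz.
  have Nge0 w : unit_disc w -> 0 <= N w.
    move=> Dw; rewrite /N mulr_ge0 ?normc_ge0// subr_ge0.
    by move/unit_discE : Dw => /ltW.
  pose E := [set N w | w in unit_disc].
  have supE : has_sup E.
    by split; [exists (N z), z | exists A0 => _ [w Dw <-]; exact: NA0].
  have ubE w : unit_disc w -> N w <= sup E.
    by move=> Dw; apply: ub_le_sup; [exact: supE.2 | exists w].
  have [S0|S0] := ltrP 0 (sup E); last first.
    by apply/eqP; rewrite eq_le Nge0// andbT (le_trans (ubE z Dz)).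
  have : sup E <= 3 / 4 * sup E.
    by apply: ge_sup; [exact: supE.1 | move=> _ [w Dw <-]; exact: step].
  by move: (sup E) S0 => s; clear; lra.
have f0 z : unit_disc z -> derive1 f z = 0.
  move=> Dz; have /eqP := N0 z Dz; rewrite /N mulf_eq0 => /orP[|].
    by move/unit_discE : Dz => z1; rewrite subr_eq0 gt_eqF.
  by rewrite normc_eq0 => /eqP.
have [_ [[n _ <-] _]] := dense _ (besov_cst (f 0 + 1) p1) _ ltr01.
rewrite iter_composition_operator => hn.
have [_ mpsi] := iter_self_map n sphi.
have D0 : unit_disc (0 : R[i]) by apply/unit_discE; rewrite normc0.
have E0 : (f \o iter n phi - cst (f 0 + 1)) 0 = - 1.
  rewrite -[LHS]/(f (iter n phi 0) - (f 0 + 1)) (derive1_eq0_cst hf f0 (mpsi 0 D0)).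
  by rewrite opprD addrA subrr add0r.
have I0 (h : R[i]^o -> R[i]^o) : 0 <= fine (besov_integral p h).
  rewrite fine_ge0// besov_integralE; apply: integral_ge0 => w _.
  by rewrite lee_fin besov_density_ge0.
have pow1 (q : R) : 1 `^ q = 1 by rewrite powR1.
move: hn; apply/negP; rewrite -leNgt /besov_norm E0 normcN normc1 pow1.
rewrite -[X in X <= _](pow1 p^-1); apply: ge0_ler_powR;
  rewrite ?nnegrE ?invr_ge0 ?(ltW p0)//; first by rewrite addr_ge0.
by rewrite lerDl.
Qed.

End BesovOperations.

Theorem theorem4p1 (R : realType) (p : R) (hp : 1 < p)
    (phi : R[i]^o -> R[i]^o) (hphi : disc_automorphism phi)
    (hbounded : bounded_on_besov p (composition_operator phi)) :
  ~ hypercyclic_on_besov p (composition_operator phi).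
Proof.
have [hol [maps _ _]] := hphi.
by apply: self_map_not_hypercyclic => //; split=> // z Dz; exact: maps.
Qed.
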